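(* Let $q\in\mathbb{C}$ be a root of unity whose order $p$ is odd, with $p\geq 3$. Let $x,y\in\mathbb{C}\setminus\{0\}$, and let $\lambda_1,\lambda_2\in\mathbb{C}$ satisfy $[\lambda_j+1-i]_q\neq 0$ for all $0\le i\le p$, $j=1,2$, and $[\lambda_1+\lambda_2-2j+1-i]_q\neq 0$ for all $0\le i\le p$, $0\le j\le p-1$. Then the $U_q(\hat{sl_2})$-module $V_{\lambda_1}(x)\otimes V_{\lambda_2}(y)$ is irreducible if and only if both of the following hold: $$\frac{y}{x}\neq q^{\lambda_1+\lambda_2-2(l-1)}\quad\text{for all } l=1,2,\dots,p-1,$$ $$\frac{y}{x}\neq q^{-(\lambda_1+\lambda_2-2(l-1))}\quad\text{for all } l=1,2,\dots,p-1.$$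
   Context: $p$ is the smallest positive integer with $q^p=1$. A logarithm $\log q$ is fixed and $q^z=\exp(z\log q)$ for $z\in\mathbb{C}$; $[z]_q=\frac{q^z-q^{-z}}{q-q^{-1}}$. $U_q(\hat{sl_2})$ is the associative $\mathbb{C}$-algebra with generators $e_i,f_i,K_i^{\pm1}$ ($i=0,1$) and relations $K_iK_i^{-1}=K_i^{-1}K_i=1$, $K_0K_1=K_1K_0$, $K_ie_iK_i^{-1}=q^2e_i$, $K_if_iK_i^{-1}=q^{-2}f_i$, $K_ie_jK_i^{-1}=q^{-2}e_j$, $K_if_jK_i^{-1}=q^2f_j$ ($i\ne j$), $[e_i,f_i]=\frac{K_i-K_i^{-1}}{q-q^{-1}}$, $[e_0,f_1]=[e_1,f_0]=0$, $e_i^3e_j-[3]_qe_i^2e_je_i+[3]_qe_ie_je_i^2-e_je_i^3=0$ and $f_i^3f_j-[3]_qf_i^2f_jf_i+[3]_qf_if_jf_i^2-f_jf_i^3=0$ ($i\neq j$). $U_q(sl_2)$ is the associative $\mathbb{C}$-algebra with generators $e,f,K^{\pm1}$ and relations $KK^{-1}=K^{-1}K=1$, $KeK^{-1}=q^2e$, $KfK^{-1}=q^{-2}f$, $[e,f]=\frac{K-K^{-1}}{q-q^{-1}}$. For $\lambda\in\mathbb{C}$, $V_\lambda$ is the $p$-dimensional $U_q(sl_2)$-module with basis $v_0,\dots,v_{p-1}$ and $Kv_i=q^{\lambda-2i}v_i$, $fv_i=[i+1]_qv_{i+1}$ ($i\neq p-1$), $fv_{p-1}=0$, $ev_i=[\lambda+1-i]_qv_{i-1}$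 ($i\ne0$), $ev_0=0$. The module $V_{\lambda_1}(x)\otimes V_{\lambda_2}(y)$ is the vector space $V_{\lambda_1}\otimes V_{\lambda_2}$ on which $U_q(\hat{sl_2})$ acts by (using the evaluation maps and the comultiplication) $e_1\mapsto e\otimes K+1\otimes e$, $f_1\mapsto f\otimes1+K^{-1}\otimes f$, $K_1\mapsto K\otimes K$, $e_0\mapsto q^{-1}x\,f\otimes K^{-1}+q^{-1}y\,1\otimes f$, $f_0\mapsto qx^{-1}\,e\otimes1+qy^{-1}\,K\otimes e$, $K_0\mapsto K^{-1}\otimes K^{-1}$. *)

(* Defs.v *)
From HB Require Import structures.
From mathcomp Require Import all_boot all_order all_algebra.
From mathcomp Require Import all_classical all_reals all_analysis.
From mathcomp Require Import complex mxtens.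
From mathcomp Require Import ring.

Set Implicit Arguments.
Unset Strict Implicit.
Unset Printing Implicit Defensive.
Import Order.TTheory GRing.Theory Num.Theory.
Local Open Scope ring_scope.
Local Open Scope quotient_scope.
Local Open Scope complex_scope.

Section IrreducibleModule.

(* [{pred M}] ranges over all subsets of [M], since every proposition is
   decidable classically. *)
Definition irreducible_module (A : pzRingType) (M : lmodType A) : Prop :=
  (exists v : M, v != 0) /\
  forall N : {pred M}, GRing.submod_closed N ->
    (forall v, v \in N -> v = 0) \/ (forall v, v \in N).

End IrreducibleModule.

(* Associative unital algebras given by generators and relations: formal
   noncommutative polynomial expressions, modulo the smallest congruence that
   contains the axioms of algebras and the given relations. *)
Section PresentedAlgebra.
Variables (C : fieldType) (I : Type).

Inductive fterm : Type :=
| Gen of I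
| Cst of C
| Add of fterm & fterm
| Mul of fterm & fterm.

HB.instance Definition _ := gen_eqMixin fterm.
HB.instance Definition _ := gen_choiceMixin fterm.

Variable rel : fterm -> fterm -> Prop.

Inductive cong : fterm -> fterm -> Prop :=
| cong_rel s t : rel s t -> cong s t
| cong_refl t : cong t t
| cong_sym s t : cong s t -> cong t s
| cong_trans s t u : cong s t -> cong t u -> cong s u
| cong_Add s s' t t' : cong s s' -> cong t t' -> cong (Add s t) (Add s' t')
| cong_Mul s s' t t' : cong s s' -> cong t t' -> cong (Mul s t) (Mul s' t')
| cong_addA s t u : cong (Add s (Add t u)) (Add (Add s t) u)
| cong_addC s t : cong (Add s t) (Add t s)
| cong_add0 t : cong (Add (Cst 0) t) t
| cong_mulA s t u : cong (Mul s (Mul t u)) (Mul (Mul s t) u)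
| cong_mul1 t : cong (Mul (Cst 1) t) t
| cong_mul0 t : cong (Mul (Cst 0) t) (Cst 0)
| cong_mulDl s t u : cong (Mul (Add s t) u) (Add (Mul s u) (Mul t u))
| cong_mulDr s t u : cong (Mul s (Add t u)) (Add (Mul s t) (Mul s u))
| cong_CstD a b : cong (Cst (a + b)) (Add (Cst a) (Cst b))
| cong_CstM a b : cong (Cst (a * b)) (Mul (Cst a) (Cst b))
| cong_CstC a t : cong (Mul (Cst a) t) (Mul t (Cst a)).

Definition congb (s t : fterm) : bool := `[< cong s t >].

Lemma congb_refl : reflexive congb.
Proof. by move=> t; apply/asboolP/cong_refl. Qed.

Lemma congb_sym : symmetric congb.
Proof. by move=> s t; apply/asboolP/asboolP; exact: cong_sym. Qed.

Lemma congb_trans : transitive congb.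
Proof.
by move=> t s u /asboolP h /asboolP h'; apply/asboolP; exact: cong_trans h h'.
Qed.

Canonical congb_equiv := EquivRel congb congb_refl congb_sym congb_trans.

Definition presented_algebra := {eq_quot congb_equiv}.

HB.instance Definition _ := Choice.on presented_algebra.
HB.instance Definition _ := EqQuotient.on presented_algebra.

Local Notation U := presented_algebra.

Lemma palgP s t : \pi_U s = \pi_U t <-> cong s t.
Proof. by split=> [/eqmodP/asboolP//|h]; apply/eqmodP/asboolP. Qed.

Definition palg_gen (i : I) : U := \pi_U (Gen i).
Definition palg_cst (a : C) : U := \pi_U (Cst a).
Definition palg_add := lift_op2 U Add.
Definition palg_mul := lift_op2 U Mul.
Definition palg_opp (u : U) : U := palg_mul (palg_cst (-1)) u.

Lemma cong_repr t : cong (repr (\pi_U t)) t.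
Proof. by apply/palgP; rewrite reprK. Qed.

Lemma palg_addE s t : palg_add (\pi_U s) (\pi_U t) = \pi_U (Add s t).
Proof. by unlock palg_add palg_mul; apply/palgP; apply: cong_Add; exact: cong_repr. Qed.

Lemma palg_mulE s t : palg_mul (\pi_U s) (\pi_U t) = \pi_U (Mul s t).
Proof. by unlock palg_add palg_mul; apply/palgP; apply: cong_Mul; exact: cong_repr. Qed.

Lemma palg_addA : associative palg_add.
Proof.
move=> u v w; rewrite -[u]reprK -[v]reprK -[w]reprK !palg_addE.
by apply/palgP; exact: cong_addA.
Qed.

Lemma palg_addC : commutative palg_add.
Proof.
move=> u v; rewrite -[u]reprK -[v]reprK !palg_addE.
by apply/palgP; exact: cong_addC.
Qed.

Lemma palg_add0 : left_id (palg_cst 0) palg_add.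
Proof. by move=> u; rewrite -[u]reprK palg_addE; apply/palgP/cong_add0. Qed.

Lemma palg_mul1 : left_id (palg_cst 1) palg_mul.
Proof. by move=> u; rewrite -[u]reprK palg_mulE; apply/palgP/cong_mul1. Qed.

Lemma palg_mulr1 : right_id (palg_cst 1) palg_mul.
Proof.
move=> u; rewrite -[u]reprK palg_mulE; apply/palgP.
exact: cong_trans (cong_sym (cong_CstC _ _)) (cong_mul1 _).
Qed.

Lemma palg_mulA : associative palg_mul.
Proof.
move=> u v w; rewrite -[u]reprK -[v]reprK -[w]reprK !palg_mulE.
by apply/palgP; exact: cong_mulA.
Qed.

Lemma palg_mulDl : left_distributive palg_mul palg_add.
Proof.
move=> u v w; rewrite -[u]reprK -[v]reprK -[w]reprK !(palg_addE, palg_mulE).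
by apply/palgP; exact: cong_mulDl.
Qed.

Lemma palg_mulDr : right_distributive palg_mul palg_add.
Proof.
move=> u v w; rewrite -[u]reprK -[v]reprK -[w]reprK !(palg_addE, palg_mulE).
by apply/palgP; exact: cong_mulDr.
Qed.

Lemma palg_cstD a b : palg_cst (a + b) = palg_add (palg_cst a) (palg_cst b).
Proof. by rewrite palg_addE; apply/palgP/cong_CstD. Qed.

Lemma palg_cstM a b : palg_cst (a * b) = palg_mul (palg_cst a) (palg_cst b).
Proof. by rewrite palg_mulE; apply/palgP/cong_CstM. Qed.

Lemma palg_cstC a u : palg_mul (palg_cst a) u = palg_mul u (palg_cst a).
Proof. by rewrite -[u]reprK !palg_mulE; apply/palgP/cong_CstC. Qed.

Lemma palg_addN : left_inverse (palg_cst 0) palg_opp palg_add.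
Proof.
move=> u; rewrite -[X in palg_add _ X]palg_mul1 -palg_mulDl -palg_cstD addNr.
by rewrite -[u]reprK palg_mulE; apply/palgP/cong_mul0.
Qed.

HB.instance Definition _ := GRing.isZmodule.Build U
  palg_addA palg_addC palg_add0 palg_addN.

HB.instance Definition _ := GRing.Zmodule_isPzRing.Build U
  palg_mulA palg_mul1 palg_mulr1 palg_mulDl palg_mulDr.

Definition palg_scale (a : C) (u : U) : U := palg_cst a * u.

Lemma palg_scaleA a b u : palg_scale a (palg_scale b u) = palg_scale (a * b) u.
Proof.
by rewrite /palg_scale mulrA; congr (_ * _); rewrite palg_cstM.
Qed.

Lemma palg_scale1 : left_id 1 palg_scale.
Proof. exact: mul1r. Qed.

Lemma palg_scaleDr : right_distributive palg_scale +%R.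
Proof. by move=> a u v; rewrite /palg_scale mulrDr. Qed.

Lemma palg_scaleDl u : {morph palg_scale^~ u : a b / a + b}.
Proof.
by move=> a b; rewrite /palg_scale -mulrDl; congr (_ * _); rewrite palg_cstD.
Qed.

HB.instance Definition _ := GRing.Zmodule_isLmodule.Build C U
  palg_scaleA palg_scale1 palg_scaleDr palg_scaleDl.

(* The library's [algType C] also demands [1 != 0], which depends on [rel]. *)
Lemma palg_scaleAl (a : C) (u v : U) : a *: (u * v) = (a *: u) * v.
Proof. exact: mulrA. Qed.

Lemma palg_scaleAr (a : C) (u v : U) : a *: (u * v) = u * (a *: v).
Proof.
have -> : a *: v = v * palg_cst a by exact: palg_cstC.
by rewrite mulrA; exact: palg_cstC.
Qed.

Section PresentedModule.
Variables (n : nat) (g : I -> 'M[C]_n).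

Fixpoint eval_mx (t : fterm) : 'M[C]_n :=
  match t with
  | Gen i => g i
  | Cst a => a%:M
  | Add s t => eval_mx s + eval_mx t
  | Mul s t => eval_mx s *m eval_mx t
  end.

Definition satisfies : Prop := forall s t, rel s t -> eval_mx s = eval_mx t.

Hypothesis g_sat : satisfies.

Lemma eval_cong s t : cong s t -> eval_mx s = eval_mx t.
Proof.
elim=> {s t} //=.
- by move=> s t u _ -> _ ->.
- by move=> s s' t t' _ -> _ ->.
- by move=> s s' t t' _ -> _ ->.
- by move=> *; rewrite addrA.
- by move=> *; rewrite addrC.
- by move=> *; rewrite raddf0 add0r.
- by move=> *; rewrite mulmxA.
- by move=> *; rewrite mul1mx.
- by move=> t; rewrite mul_scalar_mx scale0r raddf0.
- by move=> *; rewrite mulmxDl.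
- by move=> *; rewrite mulmxDr.
- by move=> *; rewrite raddfD.
- by move=> *; rewrite scalar_mxM.
- by move=> *; rewrite scalar_mxC.
Qed.

(* The module whose underlying space is C^n and on which the generator [i]
   acts by the matrix [g i]. *)
Definition presented_module of satisfies : Type := 'cV[C]_n.

Local Notation M := (presented_module g_sat).

HB.instance Definition _ := GRing.Zmodule.on M.

Definition palg_act (u : U) (v : M) : M := eval_mx (repr u) *m v.

Lemma palg_actE t (v : M) : palg_act (\pi_U t) v = eval_mx t *m v.
Proof. by rewrite /palg_act (eval_cong (cong_repr t)). Qed.

Lemma palg_actA u v (m : M) : palg_act u (palg_act v m) = palg_act (u * v) m.
Proof.
by rewrite -[u]reprK -[v]reprK [_ * _]palg_mulE !palg_actE mulmxA.
Qed.

Lemma palg_act1 : left_id 1 palg_act.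
Proof. by move=> m; rewrite palg_actE mul1mx. Qed.

Lemma palg_actDr : right_distributive palg_act +%R.
Proof. by move=> u v w; rewrite /palg_act -mulmxDr. Qed.

Lemma palg_actDl (m : M) : {morph palg_act^~ m : u v / u + v}.
Proof.
move=> u v; rewrite -[u]reprK -[v]reprK [_ + _]palg_addE !palg_actE /=.
by rewrite mulmxDl.
Qed.

HB.instance Definition _ := GRing.Zmodule_isLmodule.Build U M
  palg_actA palg_act1 palg_actDr palg_actDl.

End PresentedModule.

End PresentedAlgebra.

Arguments Gen {C I}.
Arguments Cst {C I}.
Arguments satisfies {C I} rel {n} g.
Arguments presented_module {C I rel n g} _.

Declare Scope fterm_scope.
Delimit Scope fterm_scope with F.
Bind Scope fterm_scope with fterm.
Local Notation "1" := (Cst 1) : fterm_scope.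
Local Notation "0" := (Cst 0) : fterm_scope.
Local Notation "s + t" := (Add s t) : fterm_scope.
Local Notation "s * t" := (Mul s t) : fterm_scope.
Local Notation "a *: t" := (Mul (Cst a) t) : fterm_scope.
Local Notation "s - t" := (Add s (Mul (Cst (-1)) t)) : fterm_scope.
Local Notation "t ^+ n" := (iterop n (@Mul _ _) t (Cst 1)) : fterm_scope.

Section QuantumGroups.
Variables (C : fieldType) (q : C).

Definition qnat (n : nat) : C := (q ^+ n - q ^- n) / (q - q^-1).

Inductive sl2_gen := sl2_e | sl2_f | sl2_K | sl2_Kinv.

Local Notation e := (Gen sl2_e).
Local Notation f := (Gen sl2_f).
Local Notation K := (Gen sl2_K).
Local Notation Kinv := (Gen sl2_Kinv).

Inductive Uq_sl2_rel : fterm C sl2_gen -> fterm C sl2_gen -> Prop :=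
| sl2_KKinv : Uq_sl2_rel (K * Kinv) 1
| sl2_KinvK : Uq_sl2_rel (Kinv * K) 1
| sl2_KeK : Uq_sl2_rel (K * e * Kinv) (q ^+ 2 *: e)
| sl2_KfK : Uq_sl2_rel (K * f * Kinv) (q ^- 2 *: f)
| sl2_ef : Uq_sl2_rel (e * f - f * e) ((q - q^-1)^-1 *: (K - Kinv)).

Definition Uq_sl2 := presented_algebra Uq_sl2_rel.

(* The nodes 0 and 1 of the affine Dynkin diagram are [false] and [true], so
   that [~~ i] is the node different from [i]. *)
Inductive hat_gen :=
| hat_e of bool | hat_f of bool | hat_K of bool | hat_Kinv of bool.

Local Notation "'e_ i" := (Gen (hat_e i)) (at level 8, i at level 2).
Local Notation "'f_ i" := (Gen (hat_f i)) (at level 8, i at level 2).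
Local Notation "'K_ i" := (Gen (hat_K i)) (at level 8, i at level 2).
Local Notation "'Kinv_ i" := (Gen (hat_Kinv i)) (at level 8, i at level 2).

Definition serre (s t : fterm C hat_gen) : fterm C hat_gen :=
  (s ^+ 3 * t - qnat 3 *: (s ^+ 2 * t * s) + qnat 3 *: (s * t * s ^+ 2)
   - t * s ^+ 3)%F.

Inductive Uq_sl2hat_rel : fterm C hat_gen -> fterm C hat_gen -> Prop :=
| hat_KKinv i : Uq_sl2hat_rel ('K_i * 'Kinv_i) 1
| hat_KinvK i : Uq_sl2hat_rel ('Kinv_i * 'K_i) 1
| hat_KK : Uq_sl2hat_rel ('K_false * 'K_true) ('K_true * 'K_false)
| hat_KeK i : Uq_sl2hat_rel ('K_i * 'e_i * 'Kinv_i) (q ^+ 2 *: 'e_i)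
| hat_KfK i : Uq_sl2hat_rel ('K_i * 'f_i * 'Kinv_i) (q ^- 2 *: 'f_i)
| hat_KeK' i :
    Uq_sl2hat_rel ('K_i * 'e_(~~ i) * 'Kinv_i) (q ^- 2 *: 'e_(~~ i))
| hat_KfK' i :
    Uq_sl2hat_rel ('K_i * 'f_(~~ i) * 'Kinv_i) (q ^+ 2 *: 'f_(~~ i))
| hat_ef i :
    Uq_sl2hat_rel ('e_i * 'f_i - 'f_i * 'e_i)
      ((q - q^-1)^-1 *: ('K_i - 'Kinv_i))
| hat_ef' i : Uq_sl2hat_rel ('e_i * 'f_(~~ i) - 'f_(~~ i) * 'e_i) 0
| hat_serre_e i : Uq_sl2hat_rel (serre ('e_i) ('e_(~~ i))) 0
| hat_serre_f i : Uq_sl2hat_rel (serre ('f_i) ('f_(~~ i))) 0.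

Definition Uq_sl2hat := presented_algebra Uq_sl2hat_rel.

(* Action on the tensor product of the evaluation modules with parameters [x]
   and [y]. *)
Definition hat_tensor (x y : C) (m n : nat)
    (g : sl2_gen -> 'M[C]_m) (h : sl2_gen -> 'M[C]_n) (a : hat_gen) :
    'M[C]_(m * n) :=
  match a with
  | hat_e true => g sl2_e *t h sl2_K + 1%:M *t h sl2_e
  | hat_f true => g sl2_f *t 1%:M + g sl2_Kinv *t h sl2_f
  | hat_K true => g sl2_K *t h sl2_K
  | hat_Kinv true => g sl2_Kinv *t h sl2_Kinv
  | hat_e false => (q^-1 * x) *: (g sl2_f *t h sl2_Kinv)
                   + (q^-1 * y) *: (1%:M *t h sl2_f)
  | hat_f false => (q * x^-1) *: (g sl2_e *t 1%:M)
                   + (q * y^-1) *: (g sl2_K *t h sl2_e)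
  | hat_K false => g sl2_Kinv *t h sl2_Kinv
  | hat_Kinv false => g sl2_K *t h sl2_K
  end.

Hypotheses (q0 : q != 0) (q2 : q ^+ 2 != 1).

Definition uq_ops n (e f K Ki : 'M[C]_n) :=
  [/\ K *m Ki = 1%:M, Ki *m K = 1%:M, K *m e = q ^+ 2 *: (e *m K),
      K *m f = q ^- 2 *: (f *m K) &
      e *m f - f *m e = (q - q^-1)^-1 *: (K - Ki)].

Lemma uq_ops_sat n (g : sl2_gen -> 'M[C]_n) :
  satisfies Uq_sl2_rel g <-> uq_ops (g sl2_e) (g sl2_f) (g sl2_K) (g sl2_Kinv).
Proof.
split=> [h|[h1 h2 h3 h4 h5] s t]; last first.
  case=> //=; rewrite ?mul_scalar_mx ?scaleN1r ?h3 ?h4 ?h5 -?scalemxAl -?mulmxA;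
  by rewrite ?h1 ?mulmx1.
have h1 := h _ _ sl2_KKinv; have h2 := h _ _ sl2_KinvK.
have h3 := h _ _ sl2_KeK; have h4 := h _ _ sl2_KfK.
have h5 := h _ _ sl2_ef.
move: h1 h2 h3 h4 h5; rewrite /= !mul_scalar_mx !scaleN1r.
move=> h1 h2 h3 h4 h5; split=> //.
  by rewrite scalemxAl -h3 -[RHS]mulmxA h2 mulmx1.
by rewrite scalemxAl -h4 -[RHS]mulmxA h2 mulmx1.
Qed.

Section Ops.
Variable n : nat.
Implicit Types e f K Ki X : 'M[C]_n.

Lemma uq_swap e f K Ki : uq_ops e f K Ki -> uq_ops f e Ki K.
Proof.
have sw (c : C) X A B : A *m B = 1%:M -> B *m A = 1%:M -> c != 0 ->
    A *m X = c *: (X *m A) -> B *m X = c^-1 *: (X *m B).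
  move=> AB BA c0 AX.
  have: B *m (A *m X) *m B = c *: (B *m X).
    by rewrite AX -scalemxAr -scalemxAl -!mulmxA AB mulmx1.
  by rewrite mulmxA BA mul1mx => ->; rewrite scalerA mulVf // scale1r.
case=> h1 h2 h3 h4 h5; split=> //.
- by rewrite -[q ^+ 2]invrK; apply: sw h4; rewrite ?invr_eq0 ?expf_neq0.
- by apply: sw h3; rewrite ?expf_neq0.
- by rewrite -opprB h5 -scalerN opprB.
Qed.

Definition qD (c : C) E X := locked (E *m X - c *: (X *m E)).

Lemma qDE c E X : qD c E X = E *m X - c *: (X *m E).
Proof. by rewrite /qD -lock. Qed.

Lemma qDZ c E a X : qD c E (a *: X) = a *: qD c E X.
Proof. by rewrite !qDE -scalemxAr -scalemxAl scalerBr !scalerA mulrC. Qed.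

Lemma qDD c E X Y : qD c E (X + Y) = qD c E X + qD c E Y.
Proof. by rewrite !qDE mulmxDr mulmxDl scalerDr opprD addrACA. Qed.

Lemma qD0 c E : qD c E 0 = 0.
Proof. by rewrite qDE mulmx0 mul0mx scaler0 subr0. Qed.

Lemma qDC a b E X : qD a E (qD b E X) = qD b E (qD a E X).
Proof.
rewrite !qDE !(mulmxBl, mulmxBr) -!(scalemxAl, scalemxAr) !mulmxA.
by apply/matrixP => i j; rewrite ![in LHS]mxE ![in RHS]mxE; ring.
Qed.

Lemma qnat3 : qnat 3 = q ^+ 2 + 1 + q ^- 2.
Proof.
rewrite /qnat; field; rewrite q0 /=.
by rewrite -(inj_eq (addIr 1)) subrK add0r.
Qed.

Definition serre_mx X Y :=
  X *m (X *m X) *m Y - qnat 3 *: (X *m X *m Y *m X)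
  + qnat 3 *: (X *m Y *m (X *m X)) - Y *m (X *m (X *m X)).

Lemma serre_qD E X :
  serre_mx E X = qD (q ^- 2) E (qD 1 E (qD (q ^+ 2) E X)).
Proof.
rewrite /serre_mx qnat3 !qDE !(mulmxBl, mulmxBr) -!(scalemxAl, scalemxAr).
rewrite !(mulmxBl, mulmxBr) -!(scalemxAl, scalemxAr) !mulmxA.
move: (E *m E *m E *m X) (E *m E *m X *m E) (E *m X *m E *m E).
move: (X *m E *m E *m E) => P Q R S.
by apply/matrixP => i j; rewrite !mxE; field.
Qed.

Lemma serre_uq e f K Ki : uq_ops e f K Ki -> serre_mx e f = 0.
Proof.
move=> h; have [h1 h2 h3 h4 h5] := h; have [_ _ k4 k3 _] := uq_swap h.
rewrite serre_qD [X in qD _ _ X]qDC.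
have -> : qD 1 e f = (q - q^-1)^-1 *: (K + (-1) *: Ki).
  by rewrite !qDE scale1r h5 scaleN1r.
rewrite !(qDZ, qDD); have -> : qD (q ^+ 2) e Ki = 0.
  by rewrite !qDE k3 scalerA mulfV ?expf_neq0 // scale1r subrr.
rewrite qD0 scaler0 addr0 qDC; have -> : qD (q ^- 2) e K = 0.
  by rewrite !qDE h3 scalerA mulVf ?expf_neq0 // scale1r subrr.
by rewrite qD0 scaler0.
Qed.

Lemma qD_weight a c e K X : K *m e = q ^+ 2 *: (e *m K) ->
  K *m X = c *: (X *m K) ->
  K *m qD a e X = (q ^+ 2 * c) *: (qD a e X *m K).
Proof.
move=> he hX; rewrite !qDE mulmxBr mulmxBl -scalemxAr -scalemxAl !mulmxA he hX.
rewrite -!scalemxAl -!mulmxA he hX -!scalemxAr !scalerA !scalerBr !scalerA.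
by congr (_ *: _ - _ *: _); ring.
Qed.

End Ops.

Section Tensor.
Variables m n : nat.

Lemma tensmxDl (A B : 'M[C]_m) (D : 'M[C]_n) :
  (A + B) *t D = A *t D + B *t D.
Proof. by apply/matrixP => i j; rewrite !mxE mulrDl. Qed.

Lemma tensmxDr (A : 'M[C]_m) (B D : 'M[C]_n) :
  A *t (B + D) = A *t B + A *t D.
Proof. by apply/matrixP => i j; rewrite !mxE mulrDr. Qed.

Lemma tensmxZl c (A : 'M[C]_m) (B : 'M[C]_n) : (c *: A) *t B = c *: (A *t B).
Proof. by apply/matrixP => i j; rewrite !mxE mulrA. Qed.

Lemma tensmxZr c (A : 'M[C]_m) (B : 'M[C]_n) : A *t (c *: B) = c *: (A *t B).
Proof. by apply/matrixP => i j; rewrite !mxE mulrCA. Qed.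

Lemma tensmxNl (A : 'M[C]_m) (B : 'M[C]_n) : (- A) *t B = - (A *t B).
Proof. by apply/matrixP => i j; rewrite !mxE mulNr. Qed.

Lemma tensmxNr (A : 'M[C]_m) (B : 'M[C]_n) : A *t (- B) = - (A *t B).
Proof. by apply/matrixP => i j; rewrite !mxE mulrN. Qed.

Lemma tensmx11 : (1%:M : 'M[C]_m) *t (1%:M : 'M[C]_n) = 1%:M.
Proof.
apply/matrixP => i j; case: (mxtens_indexP i) => i1 i2.
case: (mxtens_indexP j) => j1 j2; rewrite tensmxE !mxE -natrM mulnb.
by rewrite (can_eq (@mxtens_indexK _ _)) xpair_eqE.
Qed.

Definition tensE := (tensmx_mul, mulmx1, mul1mx, tensmxDl, tensmxDr, tensmxZl,
  tensmxZr, tensmxNl, tensmxNr).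

Variables (e f K Ki : 'M[C]_m) (e' f' K' Ki' : 'M[C]_n).
Hypotheses (U : uq_ops e f K Ki) (U' : uq_ops e' f' K' Ki').
Variables a b : C.

Section Serre1.

Let E := a *: (e *t K') + b *: (1%:M *t e').

Lemma serre_tens1 s t :
  serre_mx E (s *: (f *t Ki') + t *: (1%:M *t f')) = 0.
Proof.
have [h1 h2 h3 h4 h5] := U; have [_ _ k4 k3 _] := uq_swap U.
have [h1' h2' h3' h4' h5'] := U'; have [_ _ k4' k3' _] := uq_swap U'.
have q20 : q ^+ 2 != 0 by rewrite expf_neq0.
rewrite serre_qD !(qDD, qDZ).
have -> : qD (q ^+ 2) E (f *t Ki') = a *: (qD (q ^+ 2) e f *t 1%:M).
  rewrite !qDE /E !(mulmxDl, mulmxDr) -!(scalemxAl, scalemxAr) !tensE h1' h2'.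
  rewrite k3' !tensE.
  by apply/matrixP => i j; rewrite !mxE; field.
have -> X : qD 1 E (a *: (X *t 1%:M)) = a *: (a *: (qD 1 e X *t K')).
  rewrite qDZ !qDE /E !(mulmxDl, mulmxDr) -!(scalemxAl, scalemxAr) !tensE.
  by apply/matrixP => i j; rewrite !mxE; ring.
rewrite !qDZ.
have -> X : qD (q ^- 2) E (X *t K') = a *: (qD (q ^- 2) e X *t (K' *m K')).
  rewrite !qDE /E !(mulmxDl, mulmxDr) -!(scalemxAl, scalemxAr) !tensE h3' !tensE.
  by apply/matrixP => i j; rewrite !mxE; field.
rewrite -serre_qD (serre_uq U) tens0mx !scaler0 add0r.
rewrite [X in qD _ _ X]qDC qDC [X in qD _ _ X]qDC.
have -> : qD (q ^- 2) E (1%:M *t f') = b *: (1%:M *t qD (q ^- 2) e' f').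
  rewrite !qDE /E !(mulmxDl, mulmxDr) -!(scalemxAl, scalemxAr) !tensE h4' !tensE.
  by apply/matrixP => i j; rewrite !mxE; field.
have wX := qD_weight (q ^- 2) h3' h4'.
have wY := qD_weight 1 h3' wX.
set X := qD _ _ _ in wX wY *; set Y := qD _ _ _ in wY.
have -> : qD 1 E (b *: (1%:M *t X)) = b *: (b *: (1%:M *t Y)).
  rewrite qDZ !qDE /E !(mulmxDl, mulmxDr) -!(scalemxAl, scalemxAr) !tensE wX.
  rewrite mulfV // /Y qDE !tensE.
  by apply/matrixP => i j; rewrite !mxE; ring.
rewrite !qDZ.
have -> : qD (q ^+ 2) E (1%:M *t Y) = b *: (1%:M *t qD (q ^+ 2) e' Y).
  rewrite !qDE /E !(mulmxDl, mulmxDr) -!(scalemxAl, scalemxAr) !tensE wY.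
  rewrite mulfV // mulr1 !tensE.
  by apply/matrixP => i j; rewrite !mxE; ring.
have -> : qD (q ^+ 2) e' Y = serre_mx e' f'.
  by rewrite serre_qD /Y /X [in RHS]qDC [X in _ = qD _ _ X]qDC [in RHS]qDC.
by rewrite (serre_uq U') tensmx0 !scaler0.
Qed.

End Serre1.

Section Serre2.

Let E := a *: (e *t 1%:M) + b *: (K *t e').

Lemma serre_tens2 s t :
  serre_mx E (s *: (f *t 1%:M) + t *: (Ki *t f')) = 0.
Proof.
have [h1 h2 h3 h4 h5] := U; have [_ _ k4 k3 _] := uq_swap U.
have [h1' h2' h3' h4' h5'] := U'; have [_ _ k4' k3' _] := uq_swap U'.
have q20 : q ^+ 2 != 0 by rewrite expf_neq0.
rewrite serre_qD !(qDD, qDZ).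
have -> : qD (q ^+ 2) E (Ki *t f') = b *: (1%:M *t qD (q ^+ 2) e' f').
  rewrite !qDE /E !(mulmxDl, mulmxDr) -!(scalemxAl, scalemxAr) !tensE h1 h2.
  rewrite k3 !tensE.
  by apply/matrixP => i j; rewrite !mxE; field.
have -> X : qD 1 E (b *: (1%:M *t X)) = b *: (b *: (K *t qD 1 e' X)).
  rewrite qDZ !qDE /E !(mulmxDl, mulmxDr) -!(scalemxAl, scalemxAr) !tensE.
  by apply/matrixP => i j; rewrite !mxE; ring.
rewrite !qDZ.
have -> X : qD (q ^- 2) E (K *t X) = b *: ((K *m K) *t qD (q ^- 2) e' X).
  rewrite !qDE /E !(mulmxDl, mulmxDr) -!(scalemxAl, scalemxAr) !tensE h3 !tensE.
  by apply/matrixP => i j; rewrite !mxE; field.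
rewrite -(serre_qD e' f') (serre_uq U') tensmx0 !scaler0 addr0.
rewrite [X in qD _ _ X]qDC qDC [X in qD _ _ X]qDC.
have -> : qD (q ^- 2) E (f *t 1%:M) = a *: (qD (q ^- 2) e f *t 1%:M).
  rewrite !qDE /E !(mulmxDl, mulmxDr) -!(scalemxAl, scalemxAr) !tensE h4 !tensE.
  by apply/matrixP => i j; rewrite !mxE; field.
have wX := qD_weight (q ^- 2) h3 h4.
have wY := qD_weight 1 h3 wX.
set X := qD _ _ _ in wX wY *; set Y := qD _ _ _ in wY.
have -> : qD 1 E (a *: (X *t 1%:M)) = a *: (a *: (Y *t 1%:M)).
  rewrite qDZ !qDE /E !(mulmxDl, mulmxDr) -!(scalemxAl, scalemxAr) !tensE wX.
  rewrite mulfV // /Y qDE !tensE.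
  by apply/matrixP => i j; rewrite !mxE; ring.
rewrite !qDZ.
have -> : qD (q ^+ 2) E (Y *t 1%:M) = a *: (qD (q ^+ 2) e Y *t 1%:M).
  rewrite !qDE /E !(mulmxDl, mulmxDr) -!(scalemxAl, scalemxAr) !tensE wY.
  rewrite mulfV // mulr1 !tensE.
  by apply/matrixP => i j; rewrite !mxE; ring.
have -> : qD (q ^+ 2) e Y = serre_mx e f.
  by rewrite serre_qD /Y /X [in RHS]qDC [X in _ = qD _ _ X]qDC [in RHS]qDC.
by rewrite (serre_uq U) tens0mx !scaler0.
Qed.

End Serre2.

Lemma comm_tens c d : a * c = 1 -> b * d = 1 ->
  let E := a *: (e *t K') + b *: (1%:M *t e') in
  let F := c *: (f *t 1%:M) + d *: (Ki *t f') in
  E *m F - F *m E = (q - q^-1)^-1 *: (K *t K' - Ki *t Ki').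
Proof.
move=> ac bd /=.
have [h1 h2 h3 h4 h5] := U; have [_ _ k4 k3 _] := uq_swap U.
have [h1' h2' h3' h4' h5'] := U'; have [_ _ k4' k3' _] := uq_swap U'.
have q20 : q ^+ 2 != 0 by rewrite expf_neq0.
rewrite !(mulmxDl, mulmxDr) -!(scalemxAl, scalemxAr) !tensE h4' k3 !tensE.
rewrite (canRL (subrK _) h5) (canRL (subrK _) h5') !tensE.
have a0 : a != 0 by apply: contra_eq_neq ac => ->; rewrite mul0r eq_sym oner_eq0.
have b0 : b != 0 by apply: contra_eq_neq bd => ->; rewrite mul0r eq_sym oner_eq0.
have -> : c = a^-1 by rewrite -[c]mul1r -(mulVf a0) -mulrA ac mulr1.
have -> : d = b^-1 by rewrite -[d]mul1r -(mulVf b0) -mulrA bd mulr1.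
move: (q - q^-1)^-1 => D.
by apply/matrixP => i j; rewrite !mxE; field; rewrite a0 b0 q0.
Qed.

Lemma comm_tens0 c d :
  let E := a *: (f *t Ki') + b *: (1%:M *t f') in
  let F := c *: (f *t 1%:M) + d *: (Ki *t f') in
  E *m F - F *m E = 0.
Proof.
have [_ _ k4 k3 _] := uq_swap U; have [_ _ k4' k3' _] := uq_swap U'.
have q20 : q ^+ 2 != 0 by rewrite expf_neq0.
rewrite /= !(mulmxDl, mulmxDr) -!(scalemxAl, scalemxAr) !tensE k4 k4' !tensE.
by apply/matrixP => i j; rewrite !mxE; field.
Qed.

Lemma weight_tens1 :
  (K *t K') *m (a *: (e *t K') + b *: (1%:M *t e')) *m (Ki *t Ki') =
  q ^+ 2 *: (a *: (e *t K') + b *: (1%:M *t e')).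
Proof.
have [h1 h2 h3 h4 h5] := U; have [h1' h2' h3' h4' h5'] := U'.
rewrite !(mulmxDl, mulmxDr) -!(scalemxAl, scalemxAr) -?scalemxAl !tensE.
rewrite h3 h3' -!scalemxAl -!mulmxA h1 h1' !mulmx1 !tensE.
by apply/matrixP => i j; rewrite !mxE; ring.
Qed.

Lemma weight_tens2 :
  (K *t K') *m (a *: (e *t 1%:M) + b *: (K *t e')) *m (Ki *t Ki') =
  q ^+ 2 *: (a *: (e *t 1%:M) + b *: (K *t e')).
Proof.
have [h1 h2 h3 h4 h5] := U; have [h1' h2' h3' h4' h5'] := U'.
rewrite !(mulmxDl, mulmxDr) -!(scalemxAl, scalemxAr) -?scalemxAl !tensE.
rewrite h3 h3' -!scalemxAl -!mulmxA h1 h1' !mulmx1 !tensE.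
by apply/matrixP => i j; rewrite !mxE; ring.
Qed.

End Tensor.

Lemma conj_inv n (P Q X : 'M[C]_n) c : P *m Q = 1%:M -> Q *m P = 1%:M ->
  c != 0 -> Q *m X *m P = c *: X -> P *m X *m Q = c^-1 *: X.
Proof.
move=> PQ QP c0 QXP; apply: (scalerI c0); rewrite scalerA mulfV // scale1r.
by rewrite scalemxAl scalemxAr -QXP !mulmxA PQ mul1mx -mulmxA PQ mulmx1.
Qed.

Lemma hat_tensor_sat x y m n
    (g : sl2_gen -> 'M[C]_m) (h : sl2_gen -> 'M[C]_n) :
  x != 0 -> y != 0 -> satisfies Uq_sl2_rel g -> satisfies Uq_sl2_rel h ->
  satisfies Uq_sl2hat_rel (hat_tensor x y g h).
Proof.
move=> x0 y0 /uq_ops_sat U /uq_ops_sat U' s t.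
have V := uq_swap U; have V' := uq_swap U'.
have [h1 h2 _ _ _] := U; have [h1' h2' _ _ _] := U'.
set P := g sl2_K *t h sl2_K; set Q := g sl2_Kinv *t h sl2_Kinv.
have PQ : P *m Q = 1%:M by rewrite tensmx_mul h1 h1' tensmx11.
have QP : Q *m P = 1%:M by rewrite tensmx_mul h2 h2' tensmx11.
have e1E : hat_tensor x y g h (hat_e true) =
    1 *: (g sl2_e *t h sl2_K) + 1 *: (1%:M *t h sl2_e) by rewrite !scale1r.
have f1E : hat_tensor x y g h (hat_f true) =
    1 *: (g sl2_f *t 1%:M) + 1 *: (g sl2_Kinv *t h sl2_f) by rewrite !scale1r.
have e0E : hat_tensor x y g h (hat_e false) =
    (q^-1 * x) *: (g sl2_f *t h sl2_Kinv) + (q^-1 * y) *: (1%:M *t h sl2_f).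
  by [].
have f0E : hat_tensor x y g h (hat_f false) =
    (q * x^-1) *: (g sl2_e *t 1%:M) + (q * y^-1) *: (g sl2_K *t h sl2_e).
  by [].
have q20 : q ^+ 2 != 0 by rewrite expf_neq0.
have qV20 : q ^- 2 != 0 by rewrite invr_eq0.
have serreE i j : eval_mx (hat_tensor x y g h) (serre (Gen i) (Gen j)) =
    serre_mx (hat_tensor x y g h i) (hat_tensor x y g h j).
  by rewrite /= !mul_scalar_mx scaleNr scale1r scaleN1r.
case.
- by case; rewrite /= -/P -/Q.
- by case; rewrite /= -/P -/Q.
- by rewrite /= -/P -/Q PQ QP.
- case; rewrite [LHS]/= [RHS]/= mul_scalar_mx -/P -/Q.
  + rewrite -[_ + _]/(hat_tensor x y g h (hat_e true)) e1E.
    exact: weight_tens1 U U' _ _.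
  + exact: weight_tens1 V V' _ _.
- case; rewrite [LHS]/= [RHS]/= mul_scalar_mx -/P -/Q.
  + rewrite -[_ + _]/(hat_tensor x y g h (hat_f true)) f1E.
    by apply: (conj_inv PQ QP q20); exact: weight_tens2 V V' _ _.
  + by apply: (conj_inv QP PQ q20); exact: weight_tens2 U U' _ _.
- case; rewrite [LHS]/= [RHS]/= mul_scalar_mx -/P -/Q.
  + by apply: (conj_inv PQ QP q20); exact: weight_tens1 V V' _ _.
  + rewrite -[_ + _]/(hat_tensor x y g h (hat_e true)) e1E.
    by apply: (conj_inv QP PQ q20); exact: weight_tens1 U U' _ _.
- case; rewrite [LHS]/= [RHS]/= mul_scalar_mx -/P -/Q.
  + exact: weight_tens2 U U' _ _.
  + rewrite -[_ + _]/(hat_tensor x y g h (hat_f true)) f1E.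
    exact: weight_tens2 V V' _ _.
- case; cbn [eval_mx negb]; rewrite !mul_scalar_mx !scaleN1r.
  + by rewrite e1E f1E (comm_tens U U') ?mulr1.
  + rewrite e0E f0E (comm_tens V V') //.
    * by rewrite mulrACA mulVf // mulfV // mulr1.
    * by rewrite mulrACA mulVf // mulfV // mulr1.
- case; cbn [eval_mx negb]; rewrite !mul_scalar_mx !scaleN1r raddf0.
  + by rewrite e1E f0E; exact: comm_tens0 V V' _ _ _ _.
  + by rewrite e0E f1E; exact: comm_tens0 U U' _ _ _ _.
- case; rewrite serreE [RHS]raddf0 /negb.
  + by rewrite e1E e0E; exact: serre_tens1 U U' _ _ _ _.
  + by rewrite e1E e0E; exact: serre_tens1 V V' _ _ _ _.
- case; rewrite serreE [RHS]raddf0 /negb.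
  + by rewrite f1E f0E; exact: serre_tens2 V V' _ _ _ _.
  + by rewrite f1E f0E; exact: serre_tens2 U U' _ _ _ _.
Qed.

End QuantumGroups.

Section ComplexExp.
Variable R : realType.

Definition expC (z : R[i]) : R[i] :=
  (expR (complex.Re z))%:C * (cos (complex.Im z) +i* sin (complex.Im z)).

Lemma expCD z w : expC (z + w) = expC z * expC w.
Proof.
case: z w => [a b] [c d]; rewrite /expC /= expRD cosD sinD.
by apply/eqP; rewrite eq_complex /=; apply/andP; split; apply/eqP; ring.
Qed.

Lemma expC0 : expC 0 = 1.
Proof.
by rewrite /expC /= expR0 cos0 sin0; apply/eqP; rewrite eq_complex /=;
  apply/andP; split; apply/eqP; ring.
Qed.

Lemma expCN z : expC (- z) = (expC z)^-1.
Proof.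
have h : expC z * expC (- z) = 1 by rewrite -expCD subrr expC0.
have h0 : expC z != 0 by apply: contra_eq_neq h => ->; rewrite mul0r eq_sym oner_eq0.
by rewrite -[LHS]mul1r -(mulVf h0) -mulrA h mulr1.
Qed.

Lemma expC_neq0 z : expC z != 0.
Proof.
apply/eqP => h; have := expCD z (- z).
by rewrite subrr expC0 h mul0r => /eqP; rewrite oner_eq0.
Qed.

Lemma expCMn z n : expC (n%:R * z) = expC z ^+ n.
Proof.
elim: n => [|n IH]; first by rewrite mul0r expC0.
by rewrite -natr1 mulrDl mul1r expCD IH exprSr.
Qed.

End ComplexExp.

Section EvaluationModules.
Variables (R : realType) (logq : R[i]).

(* q^z and [z]_q for the branch of the logarithm with log q = [logq], so that
   q = [qpow 1]. *)
Definition qpow (z : R[i]) : R[i] := expC (z * logq).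

Definition qnum (z : R[i]) : R[i] :=
  (qpow z - qpow (- z)) / (qpow 1 - (qpow 1)^-1).

(* The matrices of the generators in the basis v_0, ..., v_(p-1): column [j]
   holds the coordinates of the image of v_j. *)
Definition V_act (p : nat) (lam : R[i]) (a : sl2_gen) : 'M[R[i]]_p :=
  match a with
  | sl2_e =>
      \matrix_(i, j) if i.+1 == j :> nat then qnum (lam + 1 - j%:R) else 0
  | sl2_f => \matrix_(i, j) if i == j.+1 :> nat then qnum (j.+1)%:R else 0
  | sl2_K => \matrix_(i, j) if i == j then qpow (lam - 2 * j%:R) else 0
  | sl2_Kinv => \matrix_(i, j) if i == j then (qpow (lam - 2 * j%:R))^-1 else 0
  end.

Variables (q : R[i]) (p : nat).
Hypotheses (logqE : expC logq = q) (q_prim : p.-primitive_root q)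
  (p_ge3 : (3 <= p)%N).

Lemma q_neq0 : q != 0.
Proof. by rewrite -logqE expC_neq0. Qed.

Lemma q2_neq1 : q ^+ 2 != 1.
Proof.
rewrite -(prim_order_dvd q_prim); apply/negP => /(dvdn_leq (isT : 0 < 2)%N).
by rewrite leqNgt p_ge3.
Qed.

Lemma qpow1 : qpow 1 = q.
Proof. by rewrite /qpow mul1r. Qed.

Lemma qpowD z w : qpow (z + w) = qpow z * qpow w.
Proof. by rewrite /qpow mulrDl expCD. Qed.

Lemma qpowN z : qpow (- z) = (qpow z)^-1.
Proof. by rewrite /qpow mulNr expCN. Qed.

Lemma qpow_neq0 z : qpow z != 0.
Proof. exact: expC_neq0. Qed.

Lemma qpow_nat n : qpow n%:R = q ^+ n.
Proof. by rewrite /qpow expCMn logqE. Qed.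

Lemma qnum0 : qnum 0%:R = 0.
Proof. by rewrite /qnum oppr0 subrr mul0r. Qed.

Lemma qnum_p : qnum p%:R = 0.
Proof.
rewrite /qnum qpowN qpow_nat (prim_expr_order q_prim).
by rewrite invr1 subrr mul0r.
Qed.

Lemma qnum_comm lam j :
  qnum (lam - j%:R) * qnum (j.+1)%:R - qnum j%:R * qnum (lam + 1 - j%:R) =
  (q - q^-1)^-1 * (qpow (lam - 2 * j%:R) - (qpow (lam - 2 * j%:R))^-1).
Proof.
rewrite /qnum !qpowN qpow1 -natr1.
have -> : lam - 2 * j%:R = lam - j%:R - j%:R by ring.
rewrite !(qpowN, qpowD) qpow1.
have Q0 := q_neq0; have X0 := qpow_neq0 lam; have Y0 := qpow_neq0 j%:R.
move: (qpow lam) (qpow j%:R) X0 Y0 => X Y X0 Y0.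
have D0 := q2_neq1.
by field; rewrite X0 Y0 Q0 -(inj_eq (addIr 1)) subrK add0r.
Qed.

Lemma V_act_sat lam : satisfies (Uq_sl2_rel q) (V_act p lam).
Proof.
apply/uq_ops_sat; split.
- apply/matrixP => i j; rewrite !mxE (bigD1 i) //= big1 ?addr0.
    rewrite !mxE eqxx; case: eqP => [<-|_]; last by rewrite mulr0.
    by rewrite mulfV ?qpow_neq0.
  by move=> k ki; rewrite !mxE eq_sym (negPf ki) mul0r.
- apply/matrixP => i j; rewrite !mxE (bigD1 i) //= big1 ?addr0.
    rewrite !mxE eqxx; case: eqP => [<-|_]; last by rewrite mulr0.
    by rewrite mulVf ?qpow_neq0.
  by move=> k ki; rewrite !mxE eq_sym (negPf ki) mul0r.
- apply/matrixP => i j; rewrite !mxE (bigD1 i) //= big1 ?addr0; last first.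
    by move=> k ki; rewrite !mxE eq_sym (negPf ki) mul0r.
  rewrite [X in _ = _ * X](bigD1 j) //= big1 ?addr0; last first.
    by move=> k ki; rewrite !mxE (negPf ki) mulr0.
  rewrite !mxE !eqxx; case: eqP => [<-|_]; last by rewrite mulr0 mul0r mulr0.
  rewrite mulrC [RHS]mulrCA; congr (_ * _).
  rewrite -(qpow_nat 2) -qpowD; congr qpow; rewrite -natr1; ring.
- apply/matrixP => i j; rewrite !mxE (bigD1 i) //= big1 ?addr0; last first.
    by move=> k ki; rewrite !mxE eq_sym (negPf ki) mul0r.
  rewrite [X in _ = _ * X](bigD1 j) //= big1 ?addr0; last first.
    by move=> k ki; rewrite !mxE (negPf ki) mulr0.
  rewrite !mxE !eqxx; case: eqP => [->|_]; last by rewrite mulr0 mul0r mulr0.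
  rewrite mulrC [RHS]mulrCA; congr (_ * _).
  rewrite -(qpow_nat 2) -qpowN -qpowD; congr qpow; rewrite -natr1; ring.
- have -> : V_act p lam sl2_e *m V_act p lam sl2_f =
      \matrix_(i, j) if i == j then qnum (lam - j%:R) * qnum (j.+1)%:R else 0.
    apply/matrixP => i j; rewrite !mxE.
    have [jp|jp] := ltnP j.+1 p.
      rewrite (bigD1 (Ordinal jp)) //= big1 ?addr0; last first.
        move=> k; rewrite -val_eqE /= => /negPf kj.
        by rewrite !mxE kj mulr0.
      rewrite !mxE /= eqxx eqSS val_eqE; case: eqP => _; last by rewrite mul0r.
      by congr (qnum _ * _); rewrite -natr1; ring.
    rewrite big1; last first.
      move=> k _; have /negPf kj : k != j.+1 :> nat.
        by rewrite neq_ltn (leq_trans (ltn_ord k) jp).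
      by rewrite !mxE kj mulr0.
    have -> : j.+1 = p by apply/eqP; rewrite eqn_leq jp ltn_ord.
    by rewrite qnum_p mulr0 if_same.
  have -> : V_act p lam sl2_f *m V_act p lam sl2_e =
      \matrix_(i, j) if i == j then qnum j%:R * qnum (lam + 1 - j%:R) else 0.
    apply/matrixP => i j; rewrite !mxE.
    case j0: (j == 0 :> nat).
      rewrite big1; last by move=> k _; rewrite !mxE (eqP j0) mulr0.
      by rewrite (eqP j0) qnum0 mul0r if_same.
    have jS : j.-1.+1 = j by rewrite prednK // lt0n j0.
    have jp : (j.-1 < p)%N by rewrite jS ltnW.
    rewrite (bigD1 (Ordinal jp)) //= big1 ?addr0; last first.
      move=> k; rewrite -val_eqE /= => kj.
      have /negPf kj' : k.+1 != j :> nat by apply: contra kj => /eqP <-.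
      by rewrite !mxE kj' mulr0.
    rewrite !mxE /= jS eqxx val_eqE; case: eqP => _; last by rewrite mul0r.
    by [].
  apply/matrixP => i j; rewrite !mxE; case: eqP => _; last first.
    by rewrite !subrr mulr0.
  exact: qnum_comm.
Qed.


Definition V_module (lam : R[i]) : lmodType (Uq_sl2 q) :=
  presented_module (V_act_sat lam).

(* The space has basis v_i (x) v_j, in the order given by [mxtens_index]. *)
Definition V_tensor (x y : R[i]) (x0 : x != 0) (y0 : y != 0)
    (lam1 lam2 : R[i]) : lmodType (Uq_sl2hat q) :=
  presented_module (hat_tensor_sat q_neq0 q2_neq1 x0 y0
                      (V_act_sat lam1) (V_act_sat lam2)).

End EvaluationModules.

(* Main.v *)
Require Import Defs.
From mathcomp Require Import all_boot all_order all_algebra.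
From mathcomp Require Import all_classical all_reals all_analysis.
From mathcomp Require Import complex mxtens.
From mathcomp Require Import ring zify.
Import Order.TTheory GRing.Theory Num.Theory.
Set Implicit Arguments.
Unset Strict Implicit.
Unset Printing Implicit Defensive.
Local Open Scope ring_scope.

(** Grade the tensor product by [i + j] on [v_i (x) v_j]. Then [E = e_1] and
[G = f_0] lower the degree by one and commute, while [F = f_1] and [H = e_0]
raise it and commute. Call the bottom vector [v_0 (x) v_0] the vacuum; it
spans the degree 0 part.

The whole question is whether [E] and [G] have a common kernel vector of
positive degree. In coordinates, [E v = G v = 0] ties each pair of neighbouring
coordinates [(i + 1, j)] and [(i, j + 1)] by two linear equations, and the
determinant of this 2 x 2 system vanishes exactly when
[y / x = q^(lambda1 + lambda2 - 2 (i + j))]. It only depends on the degree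
[l = i + j + 1], so a common kernel vector of degree [l < p] exists exactly
when the first family of conditions fails at [l]; in degrees at least [p] the
operator [E] alone is injective. The same computation for the transposed
operators [F^T] and [H^T], which lower the degree on the dual space, gives the
second family ([lowering_pair_up], [lowering_pair_down]).

If no condition fails, a nonzero submodule contains a nonzero vector whose
components have the least possible top degree. It is killed by [E] and [G],
hence is a multiple of the vacuum. So every nonzero submodule contains the
vacuum, and dually the annihilator of every proper submodule contains the
vacuum. As the vacuum does not annihilate itself, no submodule is both nonzero
and proper ([simple_of_no_resonance]).

If the first family fails at [l], let [w] be the common kernel vector of degree
[l]. The vectors whose component of each degree [d] is killed by
[E^(d + 1 - l)] form a subspace that contains [w] and vanishes in degrees below
[l], so it is nonzero and proper. It is a submodule: this follows from the
commutation relations, the Serre relation between [E] and [H], and the fact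
that the kernels of [E] and [G] in degree [l] are both the line of [w]
([singular_subspace]). If the second family fails, the same construction for
the transposed operators gives a subspace whose annihilator is a nonzero proper
submodule. *)

(** * Invariant subspaces and annihilators *)


Section Subspaces.
Variables (C : fieldType) (n : nat).
Implicit Types (S : 'cV[C]_n -> Prop) (X : 'M[C]_n) (u v : 'cV[C]_n).

Definition linear_subspace S : Prop :=
  S 0 /\ forall a u v, S u -> S v -> S (a *: u + v).

Definition stable S X : Prop := forall v, S v -> S (X *m v).

Lemma subspaceD S u v : linear_subspace S -> S u -> S v -> S (u + v).
Proof. by move=> [_ lin] Su Sv; rewrite -[u]scale1r; exact: lin. Qed.

Lemma subspaceZ S a u : linear_subspace S -> S u -> S (a *: u).
Proof. by move=> [S0 lin] Su; rewrite -[_ *: u]addr0; exact: lin. Qed.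

Lemma subspace_mulmx S m (D : 'rV[C]_m) (A : 'M[C]_(m, n)) :
  linear_subspace S -> (forall i, S (row i A)^T) -> S (D *m A)^T.
Proof.
move=> sS SA; rewrite mulmx_sum_row raddf_sum /=.
apply: (big_ind S) => [|u v|i _]; first by case: sS.
- exact: subspaceD.
- by rewrite linearZ; exact: subspaceZ (SA i).
Qed.

Definition annihilator S u : Prop := forall v, S v -> u^T *m v = 0.

Lemma subspace_annihilator S : linear_subspace (annihilator S).
Proof.
split=> [v _|a u w hu hw v Sv]; first by rewrite trmx0 mul0mx.
by rewrite linearP mulmxDl -scalemxAl hu // hw // scaler0 addr0.
Qed.

Lemma stable_annihilator S X : stable S X^T -> stable (annihilator S) X.
Proof. by move=> SX u hu v Sv; rewrite trmx_mul -mulmxA hu //; exact: SX. Qed.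

(** A matrix of maximal rank with rows in [S]
spans [S], and the columns of its cokernel are the equations of [S]. *)
Lemma proper_annihilator S v0 :
  linear_subspace S -> ~ S v0 -> exists2 u, u != 0 & annihilator S u.
Proof.
move=> sS Sv0.
pose Q k := `[< exists2 A : 'M[C]_n, \rank A = k & forall i, S (row i A)^T >].
have exQ : exists k, Q k.
  exists 0%N; apply/asboolP; exists 0; first by rewrite mxrank0.
  by move=> i; rewrite row0 trmx0; case: sS.
have ubQ k : Q k -> (k <= n)%N by move=> /asboolP[A <- _]; exact: rank_leq_row.
case: (ex_maxnP exQ ubQ) => k /asboolP[A rA SA] maxA.
have inA v : S v -> (v^T <= A)%MS.
  move=> Sv; apply/negPn/negP => nvA.
  have: Q (\rank (A + v^T)%MS).
    apply/asboolP; exists (A + v^T)%MS => // i.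
    have /sub_addsmxP[D ->] := row_sub i (A + v^T)%MS.
    rewrite raddfD; apply: subspaceD => //; first exact: subspace_mulmx.
    by apply: subspace_mulmx => // r; rewrite ord1 row_id trmxK.
  move=> /maxA; rewrite -rA leqNgt => /negP; apply; apply: rank_ltmx.
  rewrite ltmxE addsmxSl; apply: contra nvA; apply: submx_trans.
  exact: addsmxSr.
have vA : ~ (v0^T <= A)%MS.
  move=> /submxP[D vE]; apply: Sv0; rewrite -[v0]trmxK vE.
  exact: subspace_mulmx.
rewrite submxE in vA.
have {vA} vA : v0^T *m cokermx A <> 0 by move=> h; apply: vA; apply/eqP.
have [k' hk] : exists i, v0^T *m col i (cokermx A) != 0.
  apply/not_existsP => h; apply: vA; apply/rowP => i.
  have /negP := h i; rewrite negbK colE mulmxA -colE => /eqP/colP/(_ 0).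
  by rewrite !mxE.
exists (col k' (cokermx A)).
  by apply: contra_neq hk => ->; rewrite mulmx0.
move=> v /inA; rewrite submxE => /eqP vA0.
by apply: trmx_inj; rewrite trmx_mul trmxK colE mulmxA vA0 mul0mx trmx0.
Qed.
End Subspaces.


(** * Submodules of a presented module *)

Section PresentedSubmodules.
Variables (C : fieldType) (I : Type) (rel : fterm C I -> fterm C I -> Prop).
Variables (n : nat) (g : I -> 'M[C]_n) (g_sat : satisfies rel g).
Local Notation M := (presented_module g_sat).

Lemma submod_subspace (N : {pred M}) : GRing.submod_closed N ->
  linear_subspace (fun v : 'cV[C]_n => (v : M) \in N) /\
  forall i, stable (fun v : 'cV[C]_n => (v : M) \in N) (g i).
Proof.
move=> [N0 lin]; split; last first.
  move=> i v Nv; have := lin (palg_gen rel i) (v : M) 0 Nv N0.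
  by rewrite addr0 [_ *: _]palg_actE.
split=> // a u v Nu Nv; have := lin (palg_cst rel a) (u : M) (v : M) Nu Nv.
by rewrite [_ *: _]palg_actE /= mul_scalar_mx.
Qed.

Lemma subspace_submod (S : 'cV[C]_n -> Prop) : linear_subspace S ->
  (forall i, stable S (g i)) ->
  GRing.submod_closed [pred v : M | `[< S v >]].
Proof.
move=> sS Sg; split=> [|a u v]; first by apply/asboolP; exact: (proj1 sS).
move=> /asboolP Su /asboolP Sv; apply/asboolP => /=.
apply: (@subspaceD _ _ S (a *: u : M) v) => //.
rewrite -[a]reprK [_ *: _ : M]palg_actE.
elim: (repr a) u {v Sv} Su => [i|b|s IHs t IHt|s IHs t IHt] u Su /=.
- exact: Sg.
- by rewrite mul_scalar_mx; exact: subspaceZ.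
- by rewrite mulmxDl; apply: subspaceD => //; [exact: IHs|exact: IHt].
- by rewrite -mulmxA; apply/IHs/IHt.
Qed.

(** Submodules are closed under the whole algebra; by induction on expressions
it is enough to look at scalars and at the generators, which turns
irreducibility into a statement about finitely many matrices. *)
Lemma irreducible_presented : irreducible_module M <->
  (exists v : 'cV[C]_n, v != 0) /\
  forall S : 'cV[C]_n -> Prop,
    linear_subspace S -> (forall i, stable S (g i)) ->
    (forall v, S v -> v = 0) \/ (forall v, S v).
Proof.
split=> -[[v v0] irr]; split; try by exists v.
  move=> S sS Sg; have [h|h] := irr _ (subspace_submod sS Sg).
    by left=> u Su; apply: h; exact/asboolP.
  by right=> u; exact/asboolP/(h u).
by move=> N /submod_subspace[]; exact: irr.
Qed.
End PresentedSubmodules.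

(** * The submodule above a singular vector *)

Section GradedAffineAction.
Variables (C : fieldType) (n : nat) (P : nat -> 'M[C]_n).
Implicit Types (E F G H X : 'M[C]_n) (u v : 'cV[C]_n).

(** [P d] stands for the projection onto the homogeneous part of degree [d]. *)
Definition lowers_degree X : Prop :=
  X *m P 0 = 0 /\ forall d, P d *m X = X *m P d.+1.

Definition raises_degree X : Prop :=
  P 0 *m X = 0 /\ forall d, P d.+1 *m X = X *m P d.

Definition scalar_on_degrees X : Prop :=
  exists t : nat -> C, forall d, X *m P d = t d *: P d /\ P d *m X = t d *: P d.

Definition serre_relation X Y : Prop := exists c : C,
  X *m (X *m X) *m Y - c *: (X *m X *m Y *m X)
  + c *: (X *m Y *m (X *m X)) - Y *m (X *m (X *m X)) = 0.

(** The consequences of the relations of the affine algebra that the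
construction uses, for [E, F, G, H = e_1, f_1, f_0, e_0]. The list is chosen
to be invariant under the transposition that swaps [E] with [F] and [G] with
[H], so that the dual module needs no separate argument. *)
Record affine_action E F G H : Prop := AffineAction {
  lowers_E : lowers_degree E;
  raises_F : raises_degree F;
  lowers_G : lowers_degree G;
  raises_H : raises_degree H;
  comm_EF : scalar_on_degrees (E *m F - F *m E);
  comm_GH : scalar_on_degrees (G *m H - H *m G);
  comm_EG : E *m G = G *m E;
  comm_FH : F *m H = H *m F;
  serre_EH : serre_relation E H;
  serre_FG : serre_relation F G }.

Hypothesis P_idem : forall d, P d *m P d = P d.
Hypothesis P_sym : forall d, (P d)^T = P d.

Lemma lowers_degree_tr X : raises_degree X -> lowers_degree X^T.
Proof.
case=> X0 XS; split=> [|d]; apply: trmx_inj; rewrite !trmx_mul !trmxK P_sym.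
  by rewrite trmx0.
by rewrite P_sym XS.
Qed.

Lemma raises_degree_tr X : lowers_degree X -> raises_degree X^T.
Proof.
case=> X0 XS; split=> [|d]; apply: trmx_inj; rewrite !trmx_mul !trmxK P_sym.
  by rewrite trmx0.
by rewrite P_sym XS.
Qed.

Lemma scalar_on_degrees_tr X : scalar_on_degrees X -> scalar_on_degrees X^T.
Proof.
case=> t tX; exists t => d; have [XP PX] := tX d.
by split; apply: trmx_inj; rewrite trmx_mul trmxK P_sym linearZ /= P_sym.
Qed.

Lemma serre_relation_tr X Y : serre_relation X Y -> serre_relation X^T Y^T.
Proof.
case=> c /(congr1 trmx); rewrite trmx0 !(linearB, linearD) /= !linearZ /=.
rewrite !trmx_mul !mulmxA => h; exists c; apply: oppr_inj.
by rewrite oppr0 -h !mulmxA opprB opprD opprB addrA addrAC addrA scalerN.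
Qed.

Lemma affine_action_tr E F G H :
  affine_action E F G H -> affine_action F^T E^T H^T G^T.
Proof.
case=> lE rF lG rH cEF cGH cEG cFH sEH sFG; split.
- exact: lowers_degree_tr.
- exact: raises_degree_tr.
- exact: lowers_degree_tr.
- exact: raises_degree_tr.
- by have := scalar_on_degrees_tr cEF; rewrite linearB /= !trmx_mul.
- by have := scalar_on_degrees_tr cGH; rewrite linearB /= !trmx_mul.
- by rewrite -!trmx_mul cFH.
- by rewrite -!trmx_mul cEG.
- exact: serre_relation_tr.
- exact: serre_relation_tr.
Qed.

Variables (E F G H : 'M[C]_n).
Hypothesis act : affine_action E F G H.

Local Notation Epow k u := (iter k (mulmx E) u).

Lemma iter_mulmxP k a u v : Epow k (a *: u + v) = a *: Epow k u + Epow k v.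
Proof. by elim: k => //= k ->; rewrite mulmxDr -scalemxAr. Qed.

Lemma iter_mulmx0 k : Epow k 0 = 0 :> 'cV[C]_n.
Proof. by elim: k => //= k ->; rewrite mulmx0. Qed.

Lemma iter_mulmx_eq0 k m u : (k <= m)%N -> Epow k u = 0 -> Epow m u = 0.
Proof. by move=> /subnK <- h; rewrite iterD h iter_mulmx0. Qed.

Lemma iter_commute k u : Epow k (G *m u) = G *m Epow k u.
Proof.
by elim: k => //= k ->; rewrite !mulmxA (comm_EG act).
Qed.

(** Each [E] moved past [F] costs a
scalar; hence [F] increases the order of nilpotency of [E] by at most one. *)
Lemma iter_raise k d u :
  P d *m u = u -> Epow k u = 0 -> Epow k.+1 (F *m u) = 0.
Proof.
have [EP0 PE] := lowers_E act; have [t tEF] := comm_EF act.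
elim: k d u => [|k IH] d u Pu; first by move=> /= ->; rewrite !mulmx0.
rewrite iterSr => Eu.
have EFu : E *m (F *m u) = t d *: u + F *m (E *m u).
  apply/eqP; rewrite -subr_eq !mulmxA -mulmxBl -{1}Pu mulmxA.
  by have [-> _] := tEF d; rewrite -scalemxAl Pu.
rewrite iterSr EFu iter_mulmxP.
rewrite iterSr Eu scaler0 add0r.
case: d Pu {EFu} => [|d] Pu.
  by rewrite -Pu !mulmxA -[_ *m E *m _]mulmxA EP0 mulmx0 mul0mx iter_mulmx0.
by apply: (IH d) => //; rewrite mulmxA PE -mulmxA Pu.
Qed.

(** The Serre relation lets any power of [E] be moved past [H] up to at most
two factors. *)
Lemma iter_serre k u : exists a b c,
  Epow k.+2 (H *m u) = a *: (E *m (E *m (H *m Epow k u)))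
    + b *: (E *m (H *m Epow k.+1 u)) + c *: (H *m Epow k.+2 u).
Proof.
have [c0 serre] := serre_EH act.
have serreE v : E *m (E *m (E *m (H *m v))) =
    c0 *: (E *m (E *m (H *m (E *m v))))
    - c0 *: (E *m (H *m (E *m (E *m v)))) + H *m (E *m (E *m (E *m v))).
  have := congr1 (fun X => X *m v) serre.
  rewrite mul0mx !mulmxBl mulmxDl mulmxBl.
  rewrite -!scalemxAl -!mulmxA => /eqP; rewrite subr_eq0 => /eqP <-.
  by rewrite addrC addrACA subrK subrr addr0.
elim: k => [|k [a [b [c IH]]]].
  by exists 1, 0, 0; rewrite !scale0r !addr0 scale1r.
exists (a * c0 + b), (c - a * c0), a.
rewrite iterS IH !mulmxDr -!scalemxAr serreE /=.
move: (H *m (E *m (E *m (E *m _)))) (E *m (H *m (E *m (E *m _)))).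
move: (E *m (E *m (H *m _))) => X Z Y.
by apply/colP => i; rewrite !mxE; ring.
Qed.

Variables (l : nat) (w : 'cV[C]_n).
Hypothesis Pw : P l *m w = w.
Hypothesis Ew : E *m w = 0.
Hypothesis Gw : G *m w = 0.
Hypothesis uniqE :
  forall u, P l *m u = u -> E *m u = 0 -> exists a, u = a *: w.
Hypothesis uniqG :
  forall u, P l *m u = u -> G *m u = 0 -> exists a, u = a *: w.

(** [E H w] has the degree of [w] and is killed by [G], because [G] commutes
with [E] and [G H w] is a multiple of [w]. Uniqueness makes it a multiple of
[w], which [E] kills. *)
Lemma double_raise_singular : E *m (E *m (H *m w)) = 0.
Proof.
have [_ PE] := lowers_E act; have [_ PH] := raises_H act.
have [t tGH] := comm_GH act.
have [||b ->] := @uniqG (E *m (H *m w)).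
- rewrite mulmxA PE -mulmxA [P _ *m (H *m _)]mulmxA PH.
  by rewrite -[H *m _ *m _]mulmxA Pw.
- rewrite mulmxA -(comm_EG act) -mulmxA.
  have -> : G *m (H *m w) = (G *m H - H *m G) *m w.
    by rewrite mulmxBl -[H *m G *m w]mulmxA Gw mulmx0 subr0 mulmxA.
  have -> : (G *m H - H *m G) *m w = t l *: w.
    by rewrite -{1}Pw mulmxA; have [-> _] := tGH l; rewrite -scalemxAl Pw.
  by rewrite -scalemxAr Ew scaler0.
- by rewrite -scalemxAr Ew scaler0.
Qed.

(** The subtraction is truncated: in degrees [d < l] no power of [E] is
applied, so the component must vanish there. *)
Definition singular_submodule v : Prop :=
  forall d, Epow (d.+1 - l) (P d *m v) = 0.

Lemma subspace_singular : linear_subspace singular_submodule.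
Proof.
split=> [d|a u v hu hv d]; first by rewrite mulmx0 iter_mulmx0.
by rewrite mulmxDr -scalemxAr iter_mulmxP hu hv scaler0 addr0.
Qed.

(** The last power of [E] that can be nonzero lands in the kernel of [E] in
degree [l], that is, on the line of [w]. *)
Lemma singular_top d v : singular_submodule v -> (l <= d)%N ->
  exists a, Epow (d - l) (P d *m v) = a *: w.
Proof.
have [_ PE] := lowers_E act.
move=> Sv ld; apply: uniqE; last by have := Sv d; rewrite subSn.
have: forall k, (k <= d)%N ->
    P (d - k) *m Epow k (P d *m v) = Epow k (P d *m v).
  elim=> [|k IH] kd; first by rewrite subn0 mulmxA P_idem.
  rewrite iterS mulmxA PE -subSn // subSS -mulmxA IH //.
  exact: ltnW.
by move=> /(_ (d - l)%N (leq_subr _ _)); rewrite subKn.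
Qed.

Lemma stable_singular_E : stable singular_submodule E.
Proof.
have [_ PE] := lowers_E act.
move=> v Sv d; rewrite mulmxA PE -mulmxA -iterSr.
by apply: iter_mulmx_eq0 (Sv d.+1); lia.
Qed.

Lemma singular_low v d : singular_submodule v -> (d < l)%N -> P d *m v = 0.
Proof. by move=> Sv dl; have := Sv d; rewrite (eqP dl). Qed.

Lemma stable_singular_F : stable singular_submodule F.
Proof.
have [PF0 PF] := raises_F act.
move=> v Sv [|d]; first by rewrite mulmxA PF0 mul0mx iter_mulmx0.
rewrite mulmxA PF -mulmxA.
have [dl|ld] := ltnP d l.
  by rewrite (singular_low Sv dl) mulmx0 iter_mulmx0.
rewrite subSn; last exact: leqW.
by apply: (iter_raise (d := d)); rewrite ?mulmxA ?P_idem.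
Qed.

Lemma stable_singular_G : stable singular_submodule G.
Proof.
have [_ PG] := lowers_G act.
move=> v Sv d; rewrite mulmxA PG -mulmxA iter_commute.
have [dl|ld] := ltnP d.+1 l.
  by rewrite (singular_low Sv dl) iter_mulmx0 mulmx0.
by have [a ->] := singular_top Sv ld; rewrite -scalemxAr Gw scaler0.
Qed.

Lemma stable_singular_H : stable singular_submodule H.
Proof.
have [PH0 PH] := raises_H act.
move=> v Sv [|d]; first by rewrite mulmxA PH0 mul0mx iter_mulmx0.
rewrite mulmxA PH -mulmxA.
have [dl|ld] := ltnP d l.
  by rewrite (singular_low Sv dl) mulmx0 iter_mulmx0.
have := Sv d; rewrite subSn // => Sd.
rewrite subSn ?subSn //; last exact: leqW.
have [a [b [c ->]]] := iter_serre (d - l) (P d *m v).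
have [e ->] := singular_top Sv ld.
rewrite -!scalemxAr double_raise_singular Sd iterS Sd.
by rewrite !mulmx0 !scaler0 !addr0.
Qed.

Lemma stable_singular_scalar X :
  scalar_on_degrees X -> stable singular_submodule X.
Proof.
move=> [t tX] v Sv d; have [_ PX] := tX d.
rewrite mulmxA PX -scalemxAl -[X in Epow _ X]addr0 iter_mulmxP Sv.
by rewrite iter_mulmx0 addr0 scaler0.
Qed.

End GradedAffineAction.


(** * Coordinates on the tensor square *)

Section Coordinates.
Variables (C : fieldType) (p : nat).
Implicit Types (u v : 'cV[C]_(p * p)) (i j d : nat).

(** Coordinates vanish outside the range, which makes the boundary cases of the
lowering formulas uniform. *)
Definition coord v i j : C :=
  if (insub i : option 'I_p, insub j : option 'I_p) is (Some i', Some j')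
  then v (mxtens_index (i', j')) 0 else 0.

Lemma coordE v (i j : 'I_p) : coord v i j = v (mxtens_index (i, j)) 0.
Proof. by rewrite /coord !valK. Qed.

Lemma coord_lt v i j (ip : (i < p)%N) (jp : (j < p)%N) :
  coord v i j = v (mxtens_index (Ordinal ip, Ordinal jp)) 0.
Proof. by rewrite -coordE. Qed.

Lemma coord_outl v i j : (p <= i)%N -> coord v i j = 0.
Proof. by move=> pi; rewrite /coord insubF // ltnNge pi. Qed.

Lemma coord_outr v i j : (p <= j)%N -> coord v i j = 0.
Proof.
by move=> pj; rewrite /coord [insub j]insubF ?ltnNge ?pj //; case: insub.
Qed.

Lemma coord_inj u v : (forall i j, (i < p)%N -> (j < p)%N ->
  coord u i j = coord v i j) -> u = v.
Proof.
move=> h; apply/colP => s; case: (mxtens_indexP s) => i j.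
by rewrite -!coordE; apply: h.
Qed.

Lemma coordD u v i j : coord (u + v) i j = coord u i j + coord v i j.
Proof.
have [pi|ip] := leqP p i; first by rewrite !coord_outl // addr0.
have [pj|jp] := leqP p j; first by rewrite !coord_outr // addr0.
by rewrite !(coord_lt _ ip jp) mxE.
Qed.

Lemma coordZ a u i j : coord (a *: u) i j = a * coord u i j.
Proof.
have [pi|ip] := leqP p i; first by rewrite !coord_outl // mulr0.
have [pj|jp] := leqP p j; first by rewrite !coord_outr // mulr0.
by rewrite !(coord_lt _ ip jp) mxE.
Qed.

Lemma coord0 i j : coord 0 i j = 0.
Proof. by rewrite -[0 : 'cV_ _](scale0r 0) coordZ mul0r. Qed.

Definition vec_of (c : nat -> nat -> C) : 'cV[C]_(p * p) :=
  \col_s c (mxtens_unindex s).1 (mxtens_unindex s).2.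

Lemma coord_vec_of c i j :
  (i < p)%N -> (j < p)%N -> coord (vec_of c) i j = c i j.
Proof.
move=> ip jp; rewrite (coord_lt _ ip jp).
by rewrite mxE mxtens_indexK.
Qed.

Definition vacuum := vec_of (fun i j => ((i == 0) && (j == 0))%N%:R).

Lemma vacuum_pairing v : (0 < p)%N -> (vacuum^T *m v) 0 0 = coord v 0 0.
Proof.
move=> p0; rewrite (coord_lt v p0 p0) mxE.
rewrite (bigD1 (mxtens_index (Ordinal p0, Ordinal p0))) //= big1 ?addr0.
  by rewrite !mxE mxtens_indexK mul1r.
move=> s; case: (mxtens_indexP s) => i j ne; rewrite !mxE mxtens_indexK /=.
case: eqP => i0; case: eqP => j0; rewrite ?mul0r //.
by case/eqP: ne; congr (mxtens_index (_, _)); apply: val_inj.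
Qed.

Lemma coord_vacuum : (0 < p)%N -> coord vacuum 0 0 = 1.
Proof. by move=> p0; rewrite coord_vec_of. Qed.

Lemma vacuum_neq0 : (0 < p)%N -> vacuum != 0.
Proof.
move=> p0; apply/eqP => v0; have /eqP := coord_vacuum p0.
by rewrite v0 coord0 eq_sym oner_eq0.
Qed.

Definition dg (k : nat -> C) : 'M[C]_p :=
  \matrix_(i, j) if i == j then k j else 0.

Definition superdiag (k : nat -> C) : 'M[C]_p :=
  \matrix_(i, j) if i.+1 == j :> nat then k j else 0.

Lemma coord_tens (X Y : 'M[C]_p) v (i j : 'I_p) :
  coord ((X *t Y) *m v) i j =
  \sum_(k < p) \sum_(m < p) X i k * Y j m * coord v k m.
Proof.
rewrite coordE mxE pair_big /= (reindex (@mxtens_index p p)) /=; last first.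
  exists (@mxtens_unindex p p) => s _;
    by rewrite (mxtens_indexK, mxtens_unindexK).
by apply: eq_bigr => -[k m] _; rewrite tensmxE coordE.
Qed.

Lemma sum_dg k (i : 'I_p) (F : nat -> C) :
  \sum_(m < p) dg k i m * F m = k i * F i.
Proof.
rewrite (bigD1 i) //= big1 ?addr0 ?mxE ?eqxx // => m mi.
by rewrite mxE eq_sym (negPf mi) mul0r.
Qed.

Lemma sum_superdiag k (i : 'I_p) (F : nat -> C) : (F p = 0) ->
  \sum_(m < p) superdiag k i m * F m = k i.+1 * F i.+1.
Proof.
move=> Fp; have [ip|pi] := ltnP i.+1 p.
  rewrite (bigD1 (Ordinal ip)) //= big1 ?addr0 ?mxE ?eqxx //= => m mi.
  by rewrite mxE eq_sym -[_ == _]/(m == Ordinal ip) (negPf mi) mul0r.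
have ip : i.+1 = p by have := ltn_ord i; lia.
rewrite big1 => [|m _]; first by rewrite ip Fp mulr0.
by rewrite mxE ip gtn_eqF ?mul0r.
Qed.

Lemma coord_superdiag_dg a k v i j : (i < p)%N -> (j < p)%N ->
  coord ((superdiag a *t dg k) *m v) i j = a i.+1 * k j * coord v i.+1 j.
Proof.
move=> ip jp; rewrite (coord_tens _ _ _ (Ordinal ip) (Ordinal jp)).
under eq_bigr => m _.
  under eq_bigr => m' _ do rewrite -mulrA.
  rewrite -mulr_sumr sum_dg; over.
rewrite (@sum_superdiag _ _ (fun m => k j * coord v m j)) ?mulrA //.
by rewrite coord_outl ?mulr0.
Qed.

Lemma coord_dg_superdiag a k v i j : (i < p)%N -> (j < p)%N ->
  coord ((dg k *t superdiag a) *m v) i j = k i * a j.+1 * coord v i j.+1.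
Proof.
move=> ip jp; rewrite (coord_tens _ _ _ (Ordinal ip) (Ordinal jp)).
under eq_bigr => m _.
  under eq_bigr => m' _ do rewrite -mulrA.
  rewrite -mulr_sumr.
  rewrite (@sum_superdiag _ _ (coord v m) (coord_outr _ _ (leqnn p))).
  over.
by apply: etrans (sum_dg _ (Ordinal ip) (fun m => a j.+1 * coord v m j.+1)) _;
  rewrite mulrA.
Qed.

Lemma coord_dg_dg a k v i j : (i < p)%N -> (j < p)%N ->
  coord ((dg a *t dg k) *m v) i j = a i * k j * coord v i j.
Proof.
move=> ip jp; rewrite (coord_tens _ _ _ (Ordinal ip) (Ordinal jp)).
under eq_bigr => m _.
  under eq_bigr => m' _ do rewrite -mulrA.
  rewrite -mulr_sumr sum_dg; over.
by apply: etrans (sum_dg _ (Ordinal ip) (fun m => k j * coord v m j)) _;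
  rewrite mulrA.
Qed.

Lemma tr_dg k : (dg k)^T = dg k.
Proof. by apply/matrixP => i j; rewrite !mxE eq_sym; case: eqP => // ->. Qed.

Lemma dg1 : 1%:M = dg (fun=> 1).
Proof. by apply/matrixP => i j; rewrite !mxE; case: eqP. Qed.

Definition degree_proj d : 'M[C]_(p * p) :=
  diag_mx (\row_s ((mxtens_unindex s).1 + (mxtens_unindex s).2 == d)%N%:R).

Lemma coord_degree_proj d v i j :
  coord (degree_proj d *m v) i j = if (i + j == d)%N then coord v i j else 0.
Proof.
have [pi|ip] := leqP p i; first by rewrite !coord_outl // if_same.
have [pj|jp] := leqP p j; first by rewrite !coord_outr // if_same.
rewrite !(coord_lt _ ip jp).
rewrite mul_diag_mx !mxE mxtens_indexK /=.
by case: eqP => _; rewrite ?mul1r ?mul0r.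
Qed.

Lemma degree_proj_idem d : degree_proj d *m degree_proj d = degree_proj d.
Proof.
apply/matrixP => s t; rewrite mul_diag_mx !mxE.
by case: eqP => _; rewrite ?mul1r ?mul0r ?mul0rn.
Qed.

Lemma degree_proj_sym d : (degree_proj d)^T = degree_proj d.
Proof. exact: tr_diag_mx. Qed.

Lemma mulmx_ext (X Y : 'M[C]_(p * p)) :
  (forall v, X *m v = Y *m v) -> X = Y.
Proof.
move=> h; apply/matrixP => s t; have := h (delta_mx t 0).
by rewrite -!colE => /colP/(_ s); rewrite !mxE.
Qed.

Definition lowering (E : 'M[C]_(p * p)) (A B : nat -> nat -> C) : Prop :=
  forall v i j, (i < p)%N -> (j < p)%N ->
  coord (E *m v) i j = A i j * coord v i.+1 j + B i j * coord v i j.+1.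

Lemma lowering_lowers_degree E A B :
  lowering E A B -> lowers_degree degree_proj E.
Proof.
move=> hE; split=> [|d]; apply: mulmx_ext => v; apply: coord_inj => i j ip jp.
  by rewrite mul0mx coord0 -mulmxA hE // !coord_degree_proj addnS !mulr0 addr0.
rewrite -!mulmxA coord_degree_proj !hE // !coord_degree_proj addnS addSn eqSS.
by case: eqP => // _; rewrite !mulr0 addr0.
Qed.

Lemma tens_dg_scalar a k (t : nat -> C) :
  (forall i j, a i * k j = t (i + j)%N) ->
  scalar_on_degrees degree_proj (dg a *t dg k).
Proof.
move=> h; exists t => d; split; apply: mulmx_ext => v;
  apply: coord_inj => i j ip jp; rewrite -scalemxAl coordZ -mulmxA.
- rewrite coord_dg_dg // coord_degree_proj h; case: eqP => [->//|_].
  by rewrite !mulr0.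
- rewrite !coord_degree_proj coord_dg_dg // h; case: eqP => [->//|_].
  by rewrite mulr0.
Qed.

Variables (E G : 'M[C]_(p * p)) (A B A' B' : nat -> nat -> C).
Hypotheses (hE : lowering E A B) (hG : lowering G A' B').

(** In degree [l < p] the coordinate at [(0, l)] determines all others through
the two-term recursion. *)
Lemma singular_vector_unique l u X A1 B1 : (l < p)%N -> lowering X A1 B1 ->
  (forall i j, (i.+1 < p)%N -> (j < p)%N -> A1 i j != 0) ->
  degree_proj l *m u = u -> X *m u = 0 -> coord u 0 l = 0 -> u = 0.
Proof.
move=> lp hX A0 Pu Xu u0.
suff H : forall i j, (i + j = l)%N -> coord u i j = 0.
  apply: coord_inj => i j ip jp; rewrite coord0 -Pu coord_degree_proj.
  by case: eqP => // /H.
elim=> [|i IH] j ij; first by rewrite -ij in u0.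
have [pi|ip] := leqP p i.+1; first by rewrite coord_outl.
have jp : (j < p)%N by lia.
have := hX u i j (ltnW ip) jp.
rewrite Xu coord0 (IH j.+1) ?mulr0 ?addr0; last lia.
by move/esym/eqP; rewrite mulf_eq0 (negPf (A0 i j ip jp)) /= => /eqP.
Qed.

(** In degrees below [p] each pair of neighbouring coordinates solves a regular
2 x 2 system. In degrees at least [p] the equations of [E] propagate zero from
the coordinates with first index out of range. *)
Lemma common_kernel_vacuum v : (0 < p)%N ->
  (forall i j, (i < p)%N -> (j.+1 < p)%N -> B i j != 0) ->
  (forall i j, ((i + j).+1 < p)%N -> A i j * B' i j != A' i j * B i j) ->
  E *m v = 0 -> G *m v = 0 ->
  v = coord v 0 0 *: vacuum.
Proof.
move=> p0 B0 det Ev Gv.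
have low i j : ((i + j).+1 < p)%N -> coord v i.+1 j = 0 /\ coord v i j.+1 = 0.
  move=> ijp; have [ip jp] : (i < p)%N /\ (j < p)%N by lia.
  have := hG v ip jp; have := hE v ip jp; rewrite Ev Gv coord0.
  move: (det i j ijp); move: (A i j) (A' i j) (B i j) (B' i j) => a a' b b'.
  move: (coord v i.+1 j) (coord v i j.+1) => x y; rewrite -subr_eq0 => D0 e1 e2.
  split; apply/eqP.
    have: (a * b' - a' * b) * x == 0.
      apply/eqP; transitivity (b' * (a * x + b * y) - b * (a' * x + b' * y)).
        by ring.
      by rewrite -e1 -e2 !mulr0 subrr.
    by rewrite mulf_eq0 (negPf D0).
  have: (a * b' - a' * b) * y == 0.
    apply/eqP; transitivity (a * (a' * x + b' * y) - a' * (a * x + b * y)).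
      by ring.
    by rewrite -e1 -e2 !mulr0 subrr.
  by rewrite mulf_eq0 (negPf D0).
have high m i j : (i + m = p)%N -> (p <= i + j)%N -> coord v i j = 0.
  elim: m i j => [|m IH] i j im ij; first by rewrite coord_outl //; lia.
  have [pj|jp] := leqP p j; first by rewrite coord_outr.
  have [i_p j0] : (i < p)%N /\ (j = j.-1.+1)%N by lia.
  have jp' : (j.-1 < p)%N by lia.
  have := hE v i_p jp'; rewrite Ev coord0 (IH i.+1) ?mulr0 ?add0r -?j0; try lia.
  have Bn : B i j.-1 != 0 by apply: B0 => //; lia.
  by move/esym/eqP; rewrite mulf_eq0 (negPf Bn) => /eqP.
apply: coord_inj => i j ip jp; rewrite coordZ /vacuum coord_vec_of //.
have [pij|ijp] := leqP p (i + j).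
  rewrite (high (p - i)%N i j) //; last lia.
  by rewrite (_ : _ && _ = false) ?mulr0 //; lia.
case: i ip ijp => [|i] ip ijp.
  case: j jp ijp => [|j] jp ijp; first by rewrite mulr1.
  by rewrite (low 0%N j _).2 ?mulr0.
by rewrite (low i j _).1 ?mulr0.
Qed.

(** Induction on a bound for the degrees that occur in the vector: [E] and [G]
decrease the bound, so at some point both give zero. *)
Lemma vacuum_in_stable_subspace (S : 'cV[C]_(p * p) -> Prop) v : (0 < p)%N ->
  (forall i j, (i < p)%N -> (j.+1 < p)%N -> B i j != 0) ->
  (forall i j, ((i + j).+1 < p)%N -> A i j * B' i j != A' i j * B i j) ->
  linear_subspace S -> stable S E -> stable S G -> S v -> v != 0 ->
  S (vacuum).
Proof.
move=> p0 B0 det sS SE SG.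
suff H d u : (forall i j, (d <= i + j)%N -> coord u i j = 0) -> S u -> u != 0 ->
    S (vacuum).
  apply: (H (p + p)%N) => i j ij.
  have [pi|ip] := leqP p i; first by rewrite coord_outl.
  by rewrite coord_outr //; lia.
elim: d u => [|d IH] u ud Su u0.
  by case/eqP: u0; apply: coord_inj => i j _ _; rewrite ud ?coord0.
have low X A1 B1 : lowering X A1 B1 ->
    forall i j, (d <= i + j)%N -> coord (X *m u) i j = 0.
  move=> hX i j dij.
  have [pi|ip] := leqP p i; first by rewrite coord_outl.
  have [pj|jp] := leqP p j; first by rewrite coord_outr.
  by rewrite hX // !ud ?mulr0 ?addr0 //; lia.
have [Eu|/(IH _ (low _ _ _ hE) (SE _ Su))//] := eqVneq (E *m u) 0.
have [Gu|/(IH _ (low _ _ _ hG) (SG _ Su))//] := eqVneq (G *m u) 0.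
have uE := common_kernel_vacuum p0 B0 det Eu Gu.
have c0 : coord u 0 0 != 0.
  by apply: contra_neq u0 => c0; rewrite uE c0 scale0r.
rewrite -[vacuum](scalerK c0) -uE.
exact: subspaceZ.
Qed.

(** Solve the recursion of [E] from the coordinate [1] at [(0, l)]; as the
determinants vanish in this degree, the equations of [G] are proportional. *)
Lemma singular_vector_exists l : (l < p)%N ->
  (forall i j, (i.+1 < p)%N -> (j < p)%N -> A i j != 0) ->
  (forall i j, (i + j).+1 = l -> A i j * B' i j = A' i j * B i j) ->
  exists w, [/\ coord w 0 l = 1, degree_proj l *m w = w, E *m w = 0 &
    G *m w = 0].
Proof.
move=> lp A0 det.
pose c := fix c i := if i is i'.+1 then
  - (B i' (l - i'.+1)%N / A i' (l - i'.+1)%N) * c i' else 1.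
pose w := vec_of (fun i j => if (i + j == l)%N then c i else 0).
have wE i j : (i + j = l)%N -> coord w i j = c i.
  by move=> ij; rewrite coord_vec_of ?ij ?eqxx //; lia.
have w0 i j : (i + j <> l)%N -> coord w i j = 0.
  move=> ij; have [pi|ip] := leqP p i; first by rewrite coord_outl.
  have [pj|jp] := leqP p j; first by rewrite coord_outr.
  by rewrite coord_vec_of //; case: eqP.
have rec i j : (i + j).+1 = l -> A i j * c i.+1 + B i j * c i = 0.
  move=> ij; rewrite /= (_ : l - i.+1 = j)%N; last lia.
  have Aij : A i j != 0 by apply: A0; lia.
  by field.
exists w; split.
- by rewrite wE.
- apply: coord_inj => i j _ _; rewrite coord_degree_proj.
  by case: eqP => // /w0.
- apply: coord_inj => i j ip jp; rewrite hE // coord0.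
  have [ij|/eqP ij] := eqVneq (i + j).+1 l.
    by rewrite !wE ?rec ?addnS.
  by rewrite !w0 ?mulr0 ?addr0 // ?addnS.
- apply: coord_inj => i j ip jp; rewrite hG // coord0.
  have [ij|/eqP ij] := eqVneq (i + j).+1 l.
    rewrite !wE ?addnS //.
    have Aij : A i j != 0 by apply: A0; lia.
    apply: (mulfI Aij); rewrite mulr0 mulrDr [_ * (B' i j * _)]mulrA det //.
    transitivity (A' i j * (A i j * c i.+1 + B i j * c i)); first by ring.
    by rewrite rec // mulr0.
  by rewrite !w0 ?mulr0 ?addr0 // ?addnS.
Qed.

End Coordinates.


(** * Pairs of lowering operators *)

Section LoweringPairs.
Variables (C : fieldType) (p : nat).
Hypothesis p0 : (0 < p)%N.
Implicit Types (z : pred nat) (E F G H X : 'M[C]_(p * p)).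

(** [z l] records whether the 2 x 2 systems of degree [l] are singular. *)
Definition lowering_pair z E G : Prop := exists A B A' B',
  [/\ lowering E A B, lowering G A' B',
      forall i j, (i.+1 < p)%N -> (j < p)%N -> A i j != 0 /\ A' i j != 0,
      forall i j, (i < p)%N -> (j.+1 < p)%N -> B i j != 0 &
      forall i j, ((i + j).+1 < p)%N ->
        (A i j * B' i j == A' i j * B i j) = z (i + j).+1].

Lemma lowering_pair_vacuum z E G (S : 'cV[C]_(p * p) -> Prop) v :
  lowering_pair z E G -> (forall l, (0 < l < p)%N -> ~~ z l) ->
  linear_subspace S -> stable S E -> stable S G -> S v -> v != 0 ->
  S (@vacuum C p).
Proof.
move=> [A [B [A' [B' [hE hG _ B0 det]]]]] zl.
apply: (vacuum_in_stable_subspace hE hG) => // i j ij.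
by rewrite det // zl //= ij.
Qed.

Lemma scalar_on_degreesB c X Y : scalar_on_degrees (@degree_proj C p) X ->
  scalar_on_degrees (@degree_proj C p) Y ->
  scalar_on_degrees (@degree_proj C p) (c *: (X - Y)).
Proof.
move=> [t tX] [s sY]; exists (fun d => c * (t d - s d)) => d.
have [Xl Xr] := tX d; have [Yl Yr] := sY d; split.
  by rewrite -scalemxAl mulmxBl Xl Yl -scalerBl scalerA.
by rewrite -scalemxAr mulmxBr Xr Yr -scalerBl scalerA.
Qed.

Lemma singular_subspace z E F G H l :
  lowering_pair z E G -> affine_action (@degree_proj C p) E F G H ->
  (0 < l < p)%N -> z l ->
  exists S : 'cV[C]_(p * p) -> Prop,
  [/\ linear_subspace S,
      [/\ stable S E, stable S F, stable S G & stable S H],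
      forall X, scalar_on_degrees (@degree_proj C p) X -> stable S X,
      exists2 w, S w & w != 0 &
      forall v, S v -> coord v 0 0 = 0].
Proof.
move=> [A [B [A' [B' [hE hG A0 B0 det]]]]] act /andP[l0 lp] zl.
have [w [w1 Pw Ew Gw]] : exists w, [/\ coord w 0 l = 1,
    degree_proj C p l *m w = w, E *m w = 0 & G *m w = 0].
  apply: (singular_vector_exists hE hG lp) => [i j ip jp|i j ij].
    by have [] := A0 i j ip jp.
  by apply/eqP; rewrite det ij.
have uniq X A1 B1 : lowering X A1 B1 ->
    (forall i j, (i.+1 < p)%N -> (j < p)%N -> A1 i j != 0) -> X *m w = 0 ->
    forall u, degree_proj C p l *m u = u -> X *m u = 0 -> exists a, u = a *: w.
  move=> hX X0 Xw u Pu Xu; exists (coord u 0 l); apply/eqP; rewrite -subr_eq0.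
  apply/eqP/(singular_vector_unique lp hX X0).
  - by rewrite mulmxBr -scalemxAr Pu Pw.
  - by rewrite mulmxBr -scalemxAr Xu Xw scaler0 subr0.
  - by rewrite -scaleN1r coordD !coordZ w1; ring.
have uE := uniq _ _ _ hE (fun i j ip jp => (A0 i j ip jp).1) Ew.
have uG := uniq _ _ _ hG (fun i j ip jp => (A0 i j ip jp).2) Gw.
have idem := @degree_proj_idem C p.
exists (singular_submodule (@degree_proj C p) E l); split.
- exact: subspace_singular.
- split.
  + exact (stable_singular_E act (l := l)).
  + exact (stable_singular_F idem act (l := l)).
  + exact (stable_singular_G idem act Gw uE).
  + exact (stable_singular_H idem act Pw Ew Gw uE uG).
- by move=> X sX; exact (stable_singular_scalar sX).
- exists w; last first.
    apply/eqP => w0; move/eqP: w1.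
    by rewrite w0 coord0 eq_sym oner_eq0.
  move=> d; have [->|dl] := eqVneq d l; first by rewrite Pw subSnn /= Ew.
  rewrite (_ : _ *m w = 0) ?iter_mulmx0 // -Pw.
  apply: coord_inj => i j _ _; rewrite !coord_degree_proj coord0.
  by case: eqP => // -> ; rewrite (negPf dl).
- move=> v /(_ 0%N); rewrite (eqP l0) => /(congr1 (fun u => coord u 0 0)).
  by rewrite coord_degree_proj coord0.
Qed.

Lemma lowering_sum c d (a k k' b : nat -> C) :
  lowering (c *: (superdiag p a *t dg p k) + d *: (dg p k' *t superdiag p b))
    (fun i j => c * (a i.+1 * k j)) (fun i j => d * (k' i * b j.+1)).
Proof.
move=> v i j ip jp; rewrite mulmxDl -!scalemxAl coordD !coordZ.
by rewrite coord_superdiag_dg // coord_dg_superdiag // !mulrA.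
Qed.

End LoweringPairs.

(** * Tensor products of evaluation modules *)

Section EvaluationTensor.
Variables (R : realType) (q logq : R[i]) (p : nat).
Hypotheses (logqE : expC logq = q) (q_prim : p.-primitive_root q)
  (p_odd : odd p) (p_ge3 : (3 <= p)%N).
Variables (x y : R[i]) (x0 : x != 0) (y0 : y != 0) (lam1 lam2 : R[i]).
Hypotheses
  (lam1_gen : forall i : nat, (i <= p)%N -> qnum logq (lam1 + 1 - i%:R) != 0)
  (lam2_gen : forall i : nat, (i <= p)%N -> qnum logq (lam2 + 1 - i%:R) != 0).

Local Notation g := (hat_tensor q x y (V_act logq p lam1) (V_act logq p lam2)).
Local Notation P := (@degree_proj R[i] p).
Local Notation vac := (@vacuum R[i] p).

Let p0 : (0 < p)%N. Proof. exact: ltn_trans p_ge3. Qed.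
Let q0 : q != 0. Proof. exact: q_neq0 logqE. Qed.

(** As [p] is odd, [q^2] still has order [p]. *)
Lemma qnum_neq0 n : (0 < n < p)%N -> qnum logq n%:R != 0.
Proof.
move=> /andP[n0 np]; have q2 := q2_neq1 q_prim p_ge3.
rewrite /qnum qpowN (qpow_nat logqE) (qpow1 logqE).
have qn0 : q ^+ n != 0 by rewrite expf_neq0.
have qn2 : q ^+ n * q ^+ n != 1.
  rewrite -expr2 -exprM -(prim_order_dvd q_prim).
  rewrite Gauss_dvdl ?coprimen2 //; apply/negP => /(dvdn_leq n0); lia.
rewrite mulf_neq0 ?invr_eq0 // subr_eq0.
  apply: contra_neq qn2 => e; by rewrite {1}e mulVf.
by apply: contra_neq q2 => e; rewrite expr2 {1}e mulVf.
Qed.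

Lemma tensor_satisfies : satisfies (Uq_sl2hat_rel q) g.
Proof.
by apply: hat_tensor_sat => //;
  [exact: q2_neq1 q_prim p_ge3|exact: V_act_sat logqE q_prim p_ge3 _..].
Qed.

Definition resonance_up (l : nat) : bool :=
  y / x == qpow logq (lam1 + lam2 - 2 * (l%:R - 1)).
Definition resonance_down (l : nat) : bool :=
  y / x == qpow logq (- (lam1 + lam2 - 2 * (l%:R - 1))).

Local Notation kap lam := (fun j : nat => qpow logq (lam - 2 * j%:R)).

Lemma tensor_weightE i j : kap lam1 i * kap lam2 j =
  qpow logq (lam1 + lam2 - 2 * ((i + j).+1%:R - 1)).
Proof.
by rewrite -qpowD; congr qpow; rewrite -[(i + j).+1%:R]natr1 natrD; ring.
Qed.

(** The determinant at [(i, j)] is a nonzero multiple of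
[K_i K'_j / y - 1 / x], where [K_i] and [K'_j] are the weights of [v_i] and
[v_j]; their product depends on [i + j] only. *)
Lemma lowering_pair_up :
  lowering_pair resonance_up (g (hat_e true)) (g (hat_f false)).
Proof.
pose al lam (j : nat) := qnum logq (lam + 1 - j%:R).
exists (fun i j => 1 * (al lam1 i.+1 * kap lam2 j)).
exists (fun i j => 1 * (1 * al lam2 j.+1)).
exists (fun i j => (q / x) * (al lam1 i.+1 * 1)).
exists (fun i j => (q / y) * (kap lam1 i * al lam2 j.+1)).
have al1 i : (i < p)%N -> al lam1 i.+1 != 0 by exact: lam1_gen.
have al2 i : (i < p)%N -> al lam2 i.+1 != 0 by exact: lam2_gen.
split.
- have := @lowering_sum _ p 1 1 (al lam1) (kap lam2) (fun=> 1) (al lam2).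
  by rewrite -dg1 !scale1r.
- have := @lowering_sum _ p (q / x) (q / y) (al lam1) (fun=> 1)
    (kap lam1) (al lam2).
  by rewrite -dg1.
- clearbody al => i j ip jp; have a1 := al1 i (ltnW ip).
  have := qpow_neq0 logq (lam2 - 2 * j%:R); move: (qpow _ _) => k k0.
  by split; rewrite !(mulf_eq0, invr_eq0, oner_eq0, negPf a1, negPf q0,
    negPf x0, negPf k0).
- by move=> i j ip jp; rewrite !mul1r al2 // ltnW.
- move=> i j ijp; rewrite /resonance_up -tensor_weightE /=.
  have a1 : al lam1 i.+1 != 0 by apply: al1; lia.
  have a2 : al lam2 j.+1 != 0 by apply: al2; lia.
  move: (al _ _) (al _ _) a1 a2 (qpow _ _) (qpow _ _) => a b a1 a2 k2 k1.
  have -> : y / x = (a * b * q / x * y) / (a * b * q).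
    by field; rewrite x0 q0 a1 a2.
  (* Clear the denominators on both sides of the determinant equation. *)
  rewrite eq_sym -(inj_eq (mulIf y0)).
  have abq : a * b * q != 0 by rewrite !mulf_neq0.
  rewrite -[RHS](inj_eq (mulIf abq)) divfK //.
  by congr (_ == _); field; rewrite ?x0 ?y0.
Qed.

(** On the dual basis the roles of [e] and [f] are exchanged and the weights
enter through their inverses, whence the opposite exponent. *)
Lemma lowering_pair_down :
  lowering_pair resonance_down (g (hat_f true))^T (g (hat_e false))^T.
Proof.
pose be (j : nat) := qnum logq j%:R.
pose ki lam (j : nat) := (qpow logq (lam - 2 * j%:R))^-1.
have fT lam : (V_act logq p lam sl2_f)^T = superdiag p be.
  by apply/matrixP => i j; rewrite !mxE eq_sym; case: eqP => // ->.
have kT lam : (V_act logq p lam sl2_Kinv)^T = dg p (ki lam) by exact: tr_dg.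
have be0 i : (i.+1 < p)%N -> be i.+1 != 0 by move=> ip; apply: qnum_neq0.
exists (fun i j => 1 * (be i.+1 * 1)).
exists (fun i j => 1 * (ki lam1 i * be j.+1)).
exists (fun i j => (q^-1 * x) * (be i.+1 * ki lam2 j)).
exists (fun i j => (q^-1 * y) * (1 * be j.+1)).
have ki0 lam j : ki lam j != 0 by rewrite invr_eq0 qpow_neq0.
split.
- have := @lowering_sum _ p 1 1 be (fun=> 1) (ki lam1) be.
  rewrite -dg1 -trmx1 -{1}(fT lam1) -(fT lam2) -(kT lam1) -!trmx_tens.
  by rewrite !scale1r -linearD.
- have := @lowering_sum _ p (q^-1 * x) (q^-1 * y) be (ki lam2) (fun=> 1) be.
  rewrite -dg1 -trmx1 -{1}(fT lam1) -(fT lam2) -(kT lam2) -!trmx_tens.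
  by rewrite -!linearZ -linearD.
- by clearbody be ki => i j ip jp; split;
    rewrite !(mulf_eq0, invr_eq0, oner_eq0, negPf q0, negPf x0, negPf (ki0 _ _),
      negPf (be0 _ ip)).
- by clearbody be ki => i j ip jp;
    rewrite !(mulf_eq0, oner_eq0, negPf (ki0 _ _), negPf (be0 _ jp)).
- move=> i j ijp; rewrite /resonance_down qpowN -tensor_weightE /=.
  have a1 : be i.+1 != 0 by apply: be0; lia.
  have a2 : be j.+1 != 0 by apply: be0; lia.
  rewrite /ki; have := qpow_neq0 logq (lam1 - 2 * i%:R).
  have := qpow_neq0 logq (lam2 - 2 * j%:R).
  move: (be _) (be _) a1 a2 (qpow _ _) (qpow _ _) => a b a1 a2 k2 k1 k20 k10.
  have n0 : a * b / q * x != 0 by rewrite !mulf_neq0 ?invr_eq0.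
  rewrite -[RHS](inj_eq (mulfI n0)).
  by congr (_ == _); field; rewrite ?x0 ?q0 ?k10 ?k20.
Qed.

Lemma scalar_K : scalar_on_degrees P (g (hat_K true)).
Proof.
apply: (@tens_dg_scalar _ p (kap lam1) (kap lam2)
  (fun d => qpow logq (lam1 + lam2 - 2 * (d.+1%:R - 1)))) => i j.
exact: tensor_weightE.
Qed.

Lemma scalar_Kinv : scalar_on_degrees P (g (hat_Kinv true)).
Proof.
apply: (@tens_dg_scalar _ p
  (fun j => (kap lam1 j)^-1) (fun j => (kap lam2 j)^-1)
  (fun d => (qpow logq (lam1 + lam2 - 2 * (d.+1%:R - 1)))^-1)) => i j.
by rewrite -invfM tensor_weightE.
Qed.

Lemma hat_tensor_affine_action : affine_action P
  (g (hat_e true)) (g (hat_f true)) (g (hat_f false)) (g (hat_e false)).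
Proof.
have gs := tensor_satisfies; have sym := @degree_proj_sym R[i] p.
have [A [B [A' [B' [hE hG _ _ _]]]]] := lowering_pair_up.
have [A1 [B1 [A1' [B1' [hF hH _ _ _]]]]] := lowering_pair_down.
have raise X A2 B2 : lowering X^T A2 B2 -> raises_degree P X.
  by move=> /lowering_lowers_degree/(raises_degree_tr sym); rewrite trmxK.
split.
- exact: lowering_lowers_degree hE.
- exact: raise hF.
- exact: lowering_lowers_degree hG.
- exact: raise hH.
- have := gs _ _ (hat_ef q true);
  rewrite [LHS]/= [RHS]/= !mul_scalar_mx !scaleN1r => ->.
  exact: scalar_on_degreesB scalar_K scalar_Kinv.
- have := gs _ _ (hat_ef q false);
  rewrite [LHS]/= [RHS]/= !mul_scalar_mx !scaleN1r => h.
  rewrite -opprB h -scalerN opprB.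
  exact: scalar_on_degreesB scalar_K scalar_Kinv.
- have := gs _ _ (hat_ef' q true);
  rewrite [LHS]/= [RHS]/= !mul_scalar_mx !scaleN1r raddf0.
  by move=> /eqP; rewrite subr_eq0 => /eqP.
- have := gs _ _ (hat_ef' q false);
  rewrite [LHS]/= [RHS]/= !mul_scalar_mx !scaleN1r raddf0.
  by move=> /eqP; rewrite subr_eq0 => /eqP.
- exists (qnat q 3); have := gs _ _ (hat_serre_e q true).
  by rewrite /= !mul_scalar_mx scaleNr scale1r scaleN1r raddf0.
- exists (qnat q 3); have := gs _ _ (hat_serre_f q true).
  by rewrite /= !mul_scalar_mx scaleNr scale1r scaleN1r raddf0.
Qed.

Lemma stable_hat_tensor (S : 'cV[R[i]]_(p * p) -> Prop) :
  [/\ stable S (g (hat_e true)), stable S (g (hat_f true)),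
      stable S (g (hat_f false)) & stable S (g (hat_e false))] ->
  (forall X, scalar_on_degrees P X -> stable S X) -> forall a, stable S (g a).
Proof.
move=> [SE SF SG SH] Sscal.
have SK : stable S (g (hat_K true)) by apply: Sscal; exact: scalar_K.
have SKi : stable S (g (hat_Kinv true)) by apply: Sscal; exact: scalar_Kinv.
by case=> -[].
Qed.

Lemma reducible_of_resonance_up l : (0 < l < p)%N -> resonance_up l ->
  exists S : 'cV[R[i]]_(p * p) -> Prop,
  [/\ linear_subspace S, forall a, stable S (g a), exists2 w, S w & w != 0 &
      exists v, ~ S v].
Proof.
move=> lp zl.
have pu := lowering_pair_up.
have act := hat_tensor_affine_action.
have [S [sS Sops Sscal Sw S0]] := singular_subspace pu act lp zl.
exists S; split=> //; first exact: stable_hat_tensor.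
by exists vac => /S0/eqP; rewrite coord_vacuum // oner_eq0.
Qed.

(** The construction applied to the transposed operators lives on the dual
space; its annihilator is the submodule. It contains the vacuum because the
dual subspace has no component of degree 0. *)
Lemma reducible_of_resonance_down l : (0 < l < p)%N -> resonance_down l ->
  exists S : 'cV[R[i]]_(p * p) -> Prop,
  [/\ linear_subspace S, forall a, stable S (g a), exists2 w, S w & w != 0 &
      exists v, ~ S v].
Proof.
move=> lp zl; have sym := @degree_proj_sym R[i] p.
have pd := lowering_pair_down.
have act := affine_action_tr sym hat_tensor_affine_action.
have [S [sS [SF SE SH SG] Sscal [w Sw w0] S0]] :=
  singular_subspace pd act lp zl.
exists (annihilator S); split.
- exact: subspace_annihilator.
- apply: stable_hat_tensor; first by split; exact: stable_annihilator.
  by move=> X sX; apply/stable_annihilator/Sscal/(scalar_on_degrees_tr sym).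
- exists vac; last exact: vacuum_neq0.
  move=> v Sv; apply/matrixP => i j; rewrite !ord1 vacuum_pairing // S0 //.
  by rewrite mxE.
- have [s ws] : exists s, w s 0 != 0.
    apply/not_existsP => h; case/eqP: w0; apply/colP => s; rewrite mxE.
    by apply/eqP; have /negP := h s; rewrite negbK.
  exists (delta_mx s 0) => /(_ w Sw)/matrixP/(_ 0 0)/eqP.
  by rewrite trmx_delta -rowE !mxE (negPf ws).
Qed.

(** A nonzero [S] contains the vacuum, and so does the annihilator of a proper
[S], but the vacuum pairs to 1 with itself. *)
Lemma simple_of_no_resonance (S : 'cV[R[i]]_(p * p) -> Prop) :
  (forall l, (0 < l < p)%N -> ~~ resonance_up l) ->
  (forall l, (0 < l < p)%N -> ~~ resonance_down l) ->
  linear_subspace S -> (forall a, stable S (g a)) ->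
  (forall v, S v -> v = 0) \/ (forall v, S v).
Proof.
move=> up down sS Sg.
have pu := lowering_pair_up.
have pd := lowering_pair_down.
have [[v Sv v0]|S0] := pselect (exists2 v, S v & v != 0); last first.
  by left=> v Sv; apply/eqP/negPn/negP => v0; apply: S0; exists v.
right=> v1; apply: contrapT => nSv1.
have Svac : S vac.
  exact (lowering_pair_vacuum p0 pu up sS (Sg (hat_e true)) (Sg (hat_f false))
    Sv v0).
have [u u0 Su] := proper_annihilator sS nSv1.
have Avac : annihilator S vac.
  apply: (lowering_pair_vacuum p0 pd down (subspace_annihilator S) _ _ Su u0);
    by apply: stable_annihilator; rewrite trmxK; exact: Sg.
have /matrixP/(_ 0 0)/eqP := Avac _ Svac.
by rewrite vacuum_pairing // coord_vacuum // mxE oner_eq0.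
Qed.

End EvaluationTensor.

Theorem theorem2p1 (R : realType) (q logq : R[i]) (p : nat)
    (logqE : expC logq = q)
    (q_prim : p.-primitive_root q) (p_odd : odd p) (p_ge3 : (3 <= p)%N)
    (x y : R[i]) (x0 : x != 0) (y0 : y != 0) (lam1 lam2 : R[i])
    (lam1_gen : forall i : nat, (i <= p)%N -> qnum logq (lam1 + 1 - i%:R) != 0)
    (lam2_gen : forall i : nat, (i <= p)%N -> qnum logq (lam2 + 1 - i%:R) != 0)
    (lam12_gen : forall i j : nat, (i <= p)%N -> (j <= p - 1)%N ->
       qnum logq (lam1 + lam2 - 2 * j%:R + 1 - i%:R) != 0) :
  irreducible_module (V_tensor logqE q_prim p_ge3 x0 y0 lam1 lam2) <->
  (forall l : nat, (1 <= l <= p - 1)%N ->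
     y / x != qpow logq (lam1 + lam2 - 2 * (l%:R - 1))) /\
  (forall l : nat, (1 <= l <= p - 1)%N ->
     y / x != qpow logq (- (lam1 + lam2 - 2 * (l%:R - 1)))).
Proof.
apply: iff_trans (irreducible_presented _) _.
have range l : (1 <= l <= p - 1)%N = (0 < l < p)%N by lia.
have not_proper S :
    (forall v : 'cV[R[i]]_(p * p), S v -> v = 0) \/ (forall v, S v) ->
    (exists2 w, S w & w != 0) -> (exists v, ~ S v) -> False.
  by move=> [S0 [w /S0 -> /eqP]|ST _ [v nSv]] //; exact: nSv (ST v).
split=> [[_ irr]|[up down]]; last first.
  split.
    by exists (vacuum _ p); apply: vacuum_neq0; exact: ltn_trans p_ge3.
  move=> S; apply: simple_of_no_resonance => // l;
    rewrite -range; [exact: up|exact: down].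
split=> l; rewrite range => lp; apply/negP => res.
  have [S [sS Sg Sw Sv]] := reducible_of_resonance_up logqE q_prim p_odd p_ge3
    x0 y0 lam1_gen lam2_gen lp res.
  exact: not_proper (irr S sS Sg) Sw Sv.
have [S [sS Sg Sw Sv]] := reducible_of_resonance_down logqE q_prim p_odd p_ge3
  x0 y0 lam1_gen lam2_gen lp res.
exact: not_proper (irr S sS Sg) Sw Sv.
Qed.
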